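(* Let $L,M$ be finitely generated $R$-modules. Then, for almost all $\alpha$, $\operatorname{Ext}^i_R(L,M)_\alpha\cong\operatorname{Ext}^i_{R_\alpha}(L_\alpha,M_\alpha)$ for all $i\ge 0$.
   Context: Let $k$ be an arbitrary infinite field, $u=(u_1,\ldots,u_m)$ and $x=(x_1,\ldots,x_n)$ indeterminates, and $R=k(u)[x]$. Let $K$ be an extension field of $k$; for $\alpha\in K^m$ put $R_\alpha=k(\alpha)[x]$. A property holds for almost all $\alpha$ if it holds for all $\alpha\in K^m$ except perhaps those lying on a proper algebraic subvariety of $K^m$ (which may depend on the given data). Every $a\in R$ can be written $a(u,x)=p(u,x)/q(u)$ with $p\in k[u,x]$, $q\in k[u]\setminus\{0\}$; for $\alpha$ with $q(\alpha)\neq 0$ put $a(\alpha,x)=p(\alpha,x)/q(\alpha)\in R_\alpha$. For a matrix $A=(a_{ij}(u,x))$ over $R$ put $A_\alpha=(a_{ij}(\alpha,x))$; this is defined for almost all $\alpha$. The specialization $F_\alpha$ of a free $R$-module $F$ of finite rank is a free $R_\alpha$-module of the same rank. With bases fixed, the specialization $\phi_\alpha:F_\alpha\to G_\alpha$ of a homomorphism $\phi:F\to G$ of free $R$-modules of finite ranks with matrix $A$ is the homomorphism with matrix $A_\alpha$. Each finitely generated $R$-module $L$ (including $\operatorname{Ext}^i_R(L,M)$) is considered together with a fixed (arbitrary) finite free presentation $F_1\xrightarrow{\phi}F_0\to L\to 0$ (free modules of finite ranks), and its specialization is $L_\alpha:=\operatorname{Coker}\phi_\alpha$.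
   Formalization: With arbitrary presentations of each Ext^i one exceptional subvariety for all i can fail (present zero Ext^i by (u-c_i)); so it is proved for each i separately with arbitrary presentations, and for all i at once when all vanishing Ext modules share the same presentation matrix. *)

(* Defs.v *)
From HB Require Import structures.
From mathcomp Require Import all_boot all_algebra.
From mathcomp Require Import boolp classical_sets cardinality functions.
From mathcomp Require Import freeg mpoly.

Set Implicit Arguments.
Unset Strict Implicit.
Unset Printing Implicit Defensive.

Import GRing.Theory.

Local Open Scope ring_scope.
Local Open Scope quotient_scope.

Definition isomorphic (R : nzRingType) (U V : lmodType R) : Prop :=
  exists f : {linear U -> V}, bijective f.

Section Kernel.
Variables (R : nzRingType) (U V : lmodType R) (f : {linear U -> V}).

Definition ker_pred : {pred U} := fun x => f x == 0.

Lemma ker_submod : submod_closed ker_pred.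
Proof.
split=> [|a x y]; rewrite !unfold_in ?linear0 // => /eqP fx /eqP fy.
by rewrite linearP fx fy scaler0 addr0.
Qed.

HB.instance Definition _ := GRing.isSubmodClosed.Build R U ker_pred ker_submod.

Record kermod := KerMod { kermod_val : U; _ : kermod_val \in ker_pred }.

HB.instance Definition _ := [isSub for kermod_val].
HB.instance Definition _ := [Choice of kermod by <:].
HB.instance Definition _ := [SubChoice_isSubLmodule of kermod by <:].

End Kernel.

Section QuotientModule.
Variables (R : nzRingType) (V : lmodType R) (S : submodClosed V).

(* [submodClosed] does not inherit from [zmodClosed], which [Quotient] needs. *)
Definition quot_pred : {pred V} := S.

Lemma quot_pred_zmod : zmod_closed quot_pred.
Proof.
split=> [|x y]; first exact: (rpred0 S).
by rewrite /quot_pred -scaleN1r => Sx Sy; rewrite rpredD ?rpredZ.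
Qed.

HB.instance Definition _ := GRing.isZmodClosed.Build V quot_pred quot_pred_zmod.

Definition quotmod := Quotient.quot quot_pred.

HB.instance Definition _ := GRing.Zmodule.on quotmod.

Definition quotmod_scale (a : R) : quotmod -> quotmod :=
  lift_op1 quotmod (fun x => a *: x).

Lemma pi_quotmod_scale a x :
  \pi_quotmod (a *: x) = quotmod_scale a (\pi_quotmod x).
Proof.
unlock quotmod_scale; apply/eqP; rewrite -Quotient.idealrBE -scalerBr.
have: x - repr (\pi_quotmod x) \in quot_pred by rewrite Quotient.idealrBE reprK.
exact: rpredZ.
Qed.

Lemma quotmod_scalerA a b v :
  quotmod_scale a (quotmod_scale b v) = quotmod_scale (a * b) v.
Proof. by elim/quotW: v => x; rewrite -!pi_quotmod_scale scalerA. Qed.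

Lemma quotmod_scale1r : left_id 1 quotmod_scale.
Proof. by move=> v; elim/quotW: v => x; rewrite -pi_quotmod_scale scale1r. Qed.

Lemma quotmod_scalerDr : right_distributive quotmod_scale +%R.
Proof.
move=> a; elim/quotW=> x; elim/quotW=> y.
by rewrite -[LHS]/(quotmod_scale a (\pi_quotmod x + \pi_quotmod y))
  -raddfD -!pi_quotmod_scale scalerDr raddfD.
Qed.

Lemma quotmod_scalerDl v : {morph quotmod_scale^~ v : a b / a + b}.
Proof.
by move=> a b; elim/quotW: v => x; rewrite -!pi_quotmod_scale scalerDl raddfD.
Qed.

HB.instance Definition _ := GRing.Zmodule_isLmodule.Build R quotmod
  quotmod_scalerA quotmod_scale1r quotmod_scalerDr quotmod_scalerDl.

End QuotientModule.

Section Cokernel.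
Variables (R : nzRingType) (U V : lmodType R) (f : {linear U -> V}).

Definition im_pred : {pred V} := fun y => `[< exists x, y = f x >].

Lemma im_submod : submod_closed im_pred.
Proof.
split=> [|a _ _ /asboolP[x ->] /asboolP[y ->]]; apply/asboolP.
  by exists 0; rewrite linear0.
by exists (a *: x + y); rewrite linearP.
Qed.

HB.instance Definition _ := GRing.isSubmodClosed.Build R V im_pred im_submod.

Definition coker : lmodType R := quotmod im_pred.

End Cokernel.

Section Hom.
Variables (R : comNzRingType) (U V : lmodType R).

Definition hom_pred : {pred U -> V} := fun f => `[< linear f >].

Lemma hom_submod : submod_closed hom_pred.
Proof.
split=> [|a f g /asboolP lf /asboolP lg]; apply/asboolP => b x y.
  by rewrite /= scaler0 addr0.
rewrite -![(_ + _) _]/(_ + _) -![(_ *: _) _]/(_ *: _) lf lg.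
by rewrite !scalerDr !scalerA [a * b]mulrC addrACA.
Qed.

HB.instance Definition _ :=
  GRing.isSubmodClosed.Build R (U -> V) hom_pred hom_submod.

Record Hom := MkHom { hom_val :> U -> V; _ : hom_val \in hom_pred }.

HB.instance Definition _ := [isSub for hom_val].
HB.instance Definition _ := [Choice of Hom by <:].
HB.instance Definition _ := [SubChoice_isSubLmodule of Hom by <:].

Lemma hom_is_linear (f : Hom) : linear f.
Proof. by case: f => f /= /asboolP. Qed.

HB.instance Definition _ (f : Hom) :=
  GRing.isLinear.Build R U V _ f (hom_is_linear f).

End Hom.

Record free_resolution (R : nzRingType) (L : lmodType R) := FreeResolution {
  res_basis : nat -> choiceType;
  res_mod i : lmodType R := {freeg (res_basis i) / R};
  res_diff i : {linear res_mod i.+1 -> res_mod i};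
  res_aug : {linear res_mod 0 -> L};
  res_aug_surj : forall y, exists x, res_aug x = y;
  res_exact0 : forall x, res_aug x = 0 <-> exists z, x = res_diff 0 z;
  res_exactS : forall i x,
    res_diff i x = 0 <-> exists z, x = res_diff i.+1 z
}.

Section ExtResolution.
Variables (R : comNzRingType) (L M : lmodType R) (F : free_resolution L).

Section Coboundary.
Variable i : nat.

Definition codiff (f : Hom (res_mod F i) M) : res_mod F i.+1 -> M :=
  f \o res_diff F i.

Lemma codiff_hom f : codiff f \in @hom_pred R (res_mod F i.+1) M.
Proof. by apply/asboolP => a x y; rewrite /codiff /= !linearP. Qed.

Definition cobound (f : Hom (res_mod F i) M) : Hom (res_mod F i.+1) M :=
  MkHom (codiff_hom f).

Lemma cobound_linear : linear cobound.
Proof. by move=> a f g; apply/val_inj/funext => x. Qed.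

HB.instance Definition _ :=
  GRing.isLinear.Build R (Hom (res_mod F i) M) (Hom (res_mod F i.+1) M) _
    cobound cobound_linear.

End Coboundary.

Definition cocycle i : lmodType R := kermod (@cobound i).

Definition coboundary_pred i : {pred cocycle i} := fun z =>
  match i as j return Hom (res_mod F j) M -> bool with
  | 0 => fun f => f == 0
  | j.+1 => im_pred (@cobound j)
  end (val z).

Lemma coboundary_submod i : submod_closed (@coboundary_pred i).
Proof.
case: i => [|i]; split=> [|a x y].
- exact/eqP.
- move=> /eqP x0 /eqP y0; apply/eqP.
  transitivity (a *: val x + val y); first exact: linearP.
  by rewrite [val x]x0 [val y]y0 scaler0 addr0.
- exact: (rpred0 (im_pred (@cobound i))).
- have linP : val (a *: x + y) = a *: val x + val y by exact: linearP.
  rewrite !unfold_in /coboundary_pred linP.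
  by rewrite -![im_pred _ _]/(_ \in im_pred _) => Bx By; rewrite rpredD ?rpredZ.
Qed.

HB.instance Definition _ i := GRing.isSubmodClosed.Build R (cocycle i)
  (@coboundary_pred i) (@coboundary_submod i).

Definition Ext_of i : lmodType R := quotmod (@coboundary_pred i).

End ExtResolution.

(* Ext is computed from the standard resolution: the generators of each stage
   are all elements of the previous syzygy module. *)
Section StandardResolution.
Variable R : nzRingType.

Section Cover.
Variable V : lmodType R.

Definition cover : {freeg V / R} -> V := fglift id.

Lemma cover_zmod : zmod_morphism cover.
Proof. exact: lift_is_additive. Qed.

HB.instance Definition _ :=
  GRing.isZmodMorphism.Build {freeg V / R} V cover cover_zmod.

Lemma cover_scalable : scalable cover.
Proof.
move=> a D; rewrite -[D in RHS]freeg_sumE [in LHS]/GRing.scale /= /fgscale.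
rewrite !raddf_sum; apply: eq_bigr => x _.
by rewrite /= /cover !liftU scalerA.
Qed.

HB.instance Definition _ :=
  GRing.isScalable.Build R {freeg V / R} V _ cover cover_scalable.

Lemma cover_surj y : exists x, cover x = y.
Proof. by exists << y >>; rewrite /cover liftU scale1r. Qed.

End Cover.

Definition syz (V : lmodType R) : lmodType R := kermod (@cover V).

Variable L : lmodType R.

Definition std_mod i : lmodType R := {freeg (iter i syz L) / R}.

Definition std_diff i : std_mod i.+1 -> std_mod i :=
  (val : syz (iter i syz L) -> std_mod i) \o @cover (iter i.+1 syz L).

Lemma std_diff_linear i : linear (@std_diff i).
Proof. by move=> a x y; rewrite /std_diff /= !linearP. Qed.

HB.instance Definition _ i :=
  GRing.isLinear.Build R (std_mod i.+1) (std_mod i) _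
    (@std_diff i) (@std_diff_linear i).

Lemma std_exact_cover i (x : std_mod i) :
  cover x = 0 <-> exists z, x = std_diff z.
Proof.
split=> [/eqP x0 | [z ->]].
  have [z zx] := cover_surj (KerMod x0 : iter i.+1 syz L).
  by exists z; rewrite /std_diff /= zx.
by rewrite /std_diff /=; case: (cover z) => y /= /eqP.
Qed.

Lemma std_exact i (x : std_mod i.+1) :
  std_diff x = 0 <-> exists z, x = std_diff z.
Proof.
rewrite -std_exact_cover; split=> [x0 | x0]; last by rewrite /std_diff /= x0.
exact: val_inj.
Qed.

Definition std_resolution : free_resolution L :=
  @FreeResolution R L (fun i => iter i syz L) (fun i => @std_diff i)
    (@cover L) (@cover_surj L) (@std_exact_cover 0) std_exact.

End StandardResolution.

Definition Ext (R : comNzRingType) i (L M : lmodType R) : lmodType R :=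
  Ext_of M (std_resolution L) i.

(* A homomorphism [R^q -> R^p], [v |-> A v], between free modules with fixed
   bases. *)
Record free_map (R : nzRingType) := FreeMap {
  fm_cod : nat;
  fm_dom : nat;
  fm_mx : 'M[R]_(fm_cod, fm_dom)
}.

Record presentation (R : comNzRingType) (L : lmodType R) := Presentation {
  pres_map :> free_map R;
  pres_aug : {linear 'cV[R]_(fm_cod pres_map) -> L};
  pres_surj : forall y, exists x, pres_aug x = y;
  pres_exact : forall x,
    pres_aug x = 0 <-> exists z, x = fm_mx pres_map *m z
}.

Section AlmostAll.
Variables (m : nat) (K : fieldType).

(* Subvarieties need not be irreducible. *)
Definition zero_locus (s : seq {mpoly K[m]}) : set ('I_m -> K) :=
  [set a | forall p, p \in s -> p.@[a] = 0]%classic.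

Definition almost_all (P : ('I_m -> K) -> Prop) : Prop :=
  exists s, zero_locus s <> [set: _]%classic /\ forall a, ~ zero_locus s a -> P a.

End AlmostAll.

Notation gen_ring k m n := {mpoly {fraction {mpoly k[m]}}[n]}.

Section Specialization.
Variables (k : fieldType) (m n : nat) (K : fieldType).
Variables (iota : {rmorphism k -> K}) (alpha : 'I_m -> K).

Local Notation evK := (mmap iota alpha : {mpoly k[m]} -> K).

Definition adjoin_pred : {pred K} := fun z =>
  `[< exists p q : {mpoly k[m]}, evK q != 0 /\ z = evK p / evK q >].

Lemma adjoin_divring : divring_closed adjoin_pred.
Proof.
split=> [|_ _ /asboolP[p [q [q0 ->]]] /asboolP[r [s [s0 ->]]]
         |_ _ /asboolP[p [q [q0 ->]]] /asboolP[r [s [s0 ->]]]]; apply/asboolP.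
- by exists 1, 1; rewrite rmorph1 divr1 oner_eq0.
- exists (p * s - r * q), (q * s); rewrite !(rmorphM, rmorphB) /= mulf_neq0 //.
  by rewrite -[- (_ / _)]mulNr addf_div ?mulNr.
- have [r0|r0] := eqVneq (evK r) 0.
    by exists 0, 1; rewrite rmorph0 rmorph1 oner_eq0 r0 !mul0r invr0 mulr0.
  exists (p * s), (q * r); rewrite !rmorphM /= mulf_neq0 //.
  by rewrite invf_div mulf_div.
Qed.

HB.instance Definition _ :=
  GRing.isDivringClosed.Build K adjoin_pred adjoin_divring.

Record adjoin := Adjoin { adjoin_val : K; _ : adjoin_val \in adjoin_pred }.

HB.instance Definition _ := [isSub for adjoin_val].
HB.instance Definition _ := [Choice of adjoin by <:].
HB.instance Definition _ := [SubChoice_isSubIntegralDomain of adjoin by <:].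
HB.instance Definition _ := [SubIntegralDomain_isSubField of adjoin by <:].

Lemma ev_adjoin p : evK p \in adjoin_pred.
Proof. by apply/asboolP; exists p, 1; rewrite rmorph1 divr1 oner_eq0. Qed.

Definition ev (p : {mpoly k[m]}) : adjoin := Adjoin (ev_adjoin p).

Definition has_spec_at (a : gen_ring k m n)
    (pq : {mpoly {mpoly k[m]}[n]} * {mpoly k[m]}) : Prop :=
  ev pq.2 != 0 /\ a = (tofrac pq.2)^-1 *: map_mpoly (@tofrac _) pq.1.

(* [a(alpha, x)], with the dummy value [0] where it is not defined. *)
Definition spec (a : gen_ring k m n) : {mpoly adjoin[n]} :=
  if pselect (exists pq, has_spec_at a pq) is left ex_pq then
    let pq := projT1 (cid ex_pq) in (ev pq.2)^-1 *: map_mpoly ev pq.1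
  else 0.

Lemma ev_zmod : zmod_morphism ev.
Proof. by move=> p q; apply: val_inj; rewrite /= rmorphB. Qed.

Lemma ev_monoid : monoid_morphism ev.
Proof.
by split=> [|p q]; apply: val_inj; rewrite /= ?rmorph1 ?rmorphM.
Qed.

HB.instance Definition _ :=
  GRing.isZmodMorphism.Build {mpoly k[m]} adjoin ev ev_zmod.
HB.instance Definition _ :=
  GRing.isMonoidMorphism.Build {mpoly k[m]} adjoin ev ev_monoid.

Lemma has_spec_at_coef a pq i : has_spec_at a pq ->
  tofrac pq.2 * a@_i = tofrac pq.1@_i.
Proof.
case: pq => p q [/= q0 ->]; rewrite mcoeffZ mcoeff_map_mpoly mulrA divff ?mul1r//.
apply: contraNneq q0 => /eqP; rewrite tofrac_eq0 => /eqP->.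
by rewrite rmorph0.
Qed.

Lemma specE a pq : has_spec_at a pq ->
  spec a = (ev pq.2)^-1 *: map_mpoly ev pq.1.
Proof.
move=> h; rewrite /spec; case: pselect => [ex_pq|nex]; last by case: nex; exists pq.
case: (cid ex_pq) => rs h' /=; apply/mpolyP => i.
have eps : pq.2 * rs.1@_i = rs.2 * pq.1@_i.
  apply/eqP; rewrite -tofrac_eq !tofracM.
  by rewrite -(has_spec_at_coef i h) -(has_spec_at_coef i h') mulrCA.
rewrite !mcoeffZ !mcoeff_map_mpoly ![_^-1 * _]mulrC.
apply/eqP; rewrite eqr_div ?h.1 ?h'.1 // -!rmorphM.
by rewrite mulrC eps mulrC.
Qed.

Definition spec_defined (A : free_map (gen_ring k m n)) : Prop :=
  forall i j, exists pq, has_spec_at (fm_mx A i j) pq.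

Definition spec_coker (A : free_map (gen_ring k m n)) :
    lmodType {mpoly adjoin[n]} :=
  coker (mulmx (map_mx spec (fm_mx A)) :
    {linear 'cV_(fm_dom A) -> 'cV_(fm_cod A)}).

Definition ext_specializes (L M : lmodType (gen_ring k m n)) i
    (PL : presentation L) (PM : presentation M)
    (PE : presentation (Ext i L M)) : Prop :=
  [/\ spec_defined PL, spec_defined PM, spec_defined PE &
      isomorphic (spec_coker PE) (Ext i (spec_coker PL) (spec_coker PM))].

End Specialization.

(* Main.v *)
Require Import Defs.
From mathcomp Require Import all_boot all_order all_algebra.
From mathcomp Require Import boolp classical_sets cardinality functions.
From mathcomp Require Import ssrcomplements freeg mpoly.
From mathcomp Require Import ring.
From HB Require Import structures.
(* [all_algebra] shadows [Defs.Hom]. *)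
Import Defs.

Set Implicit Arguments.
Unset Strict Implicit.
Unset Printing Implicit Defensive.
Import Order.TTheory GRing.Theory.
Local Open Scope ring_scope.
Local Open Scope quotient_scope.

(* Let R = k(u)[x].  Given a matrix B over R, division by a Groebner basis yields
   a k(u)-linear (not R-linear) map s with B s B = B which is defined over a
   finitely generated subring of k(u).  If im C = ker B, such maps for B and C
   combine into a k(u)-linear contracting homotopy of C, B, which specializes at
   almost all alpha; hence kernels of matrices commute with specialization.
   Ext^0 and Ext^1 are homology modules of complexes built from finitely many
   matrices, so they specialize, and higher Ext modules reduce to Ext^1 by
   replacing L with a syzygy.  For i > n both sides vanish by Hilbert's syzygy
   theorem, so that finitely many exceptional subvarieties suffice.

   The syzygy theorem is proved one variable at a time: if X is projective
   relative to K[x_0, ..., x_(j-1)], i.e. maps from X linear over this subring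
   lift along R-linear surjections, then the syzygy of X is projective relative
   to K[x_0, ..., x_j]. *)

(** * Ext through syzygies and matrices *)

(** A map [s] with B s B = B that is linear over R exists only if the image of B is a direct
    summand, hence the retreat to k(u)-linearity. Such a map is given by its values on infinitely
    many monomials, yet one nonzero polynomial must clear all their denominators: division by monic
    elements creates no denominators beyond the coefficients of the basis and of its cofactors.
    Linearity over constants is enough to specialize, because the coefficients of a vector that
    specializes to 0 specialize to 0 themselves. Ext is defined by the standard resolution, whose
    free modules are generated by all elements of a module and so are not given by matrices. It is
    compared with finite matrices through isomorphism in the stable module category, which passes to
    syzygies and determines Ext^1. Every exceptional set is contained in a hypersurface q = 0 with q
    nonzero over k. Over an infinite k some point of k^m avoids it, so it is proper in K^m. *)

Definition lin_fun (R : nzRingType) (U V : lmodType R) (f : U -> V)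
  of linear f := f.

HB.instance Definition _ (R : nzRingType) (U V : lmodType R) (f : U -> V)
  (lf : linear f) := GRing.isLinear.Build R U V _ (lin_fun lf) lf.

Definition mklin (R : nzRingType) (U V : lmodType R) (f : U -> V)
  (lf : linear f) : {linear U -> V} := lin_fun lf.

Definition surj (A B : Type) (f : A -> B) := forall y, exists x, f x = y.

Section FreegLift.
Variables (R : comNzRingType) (B : choiceType) (U : lmodType R) (s : B -> U).

Definition flift : {freeg B / R} -> U := fglift s.

HB.instance Definition _ := GRing.isZmodMorphism.Build {freeg B / R} U flift
  (@lift_is_additive R B U s).

Lemma flift_scalable : scalable flift.
Proof.
move=> a D; rewrite -[D in RHS]freeg_sumE [in LHS]/GRing.scale /= /fgscale.
rewrite !raddf_sum; apply: eq_bigr => x _.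
by rewrite /= /flift !liftU scalerA.
Qed.

HB.instance Definition _ :=
  GRing.isScalable.Build R {freeg B / R} U _ flift flift_scalable.

Lemma fliftE b : flift << b >> = s b.
Proof. by rewrite /flift liftU scale1r. Qed.

End FreegLift.

Section Modules.
Variable R : comNzRingType.
Implicit Types U V W X Y P Q M E : lmodType R.

(** First isomorphism theorem: [g] after a section of [f] is well defined because the kernels agree.
    Ext modules are compared by exhibiting them as images of one module. *)
Lemma iso_of_surj U V W (f : {linear U -> V}) (g : {linear U -> W}) :
  surj f -> surj g -> (forall u, f u = 0 <-> g u = 0) -> isomorphic V W.
Proof.
move=> /choice[s sP] /choice[t tP] fg.
have fgE u u' : f u = f u' <-> g u = g u'.
  by split=> /eqP; rewrite -subr_eq0 -linearB => /eqP/fg/eqP;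
    rewrite linearB subr_eq0 => /eqP.
have lh : linear (fun v => g (s v)).
  by move=> a v v'; rewrite -linearP; apply/fgE; rewrite linearP !sP.
exists (mklin lh); exists (fun w => f (t w)) => x /=.
  by rewrite -[RHS]sP; apply/fgE; rewrite tP.
by rewrite -[RHS]tP; apply/fgE; rewrite sP.
Qed.

Lemma isomorphic_sym U V : isomorphic U V -> isomorphic V U.
Proof.
case=> f [g fg gf]; have lg : linear g.
  by move=> a x y; rewrite -{1}[x]gf -{1}[y]gf -linearP fg.
by exists (mklin lg); exists f.
Qed.

Lemma isomorphic_trans V U W : isomorphic U V -> isomorphic V W -> isomorphic U W.
Proof.
case=> f bf [g bg]; have lgf : linear (g \o f) by move=> a x y; rewrite /= !linearP.
by exists (mklin lgf); apply: bij_comp.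
Qed.

Lemma quotmod_proj V (S : submodClosed V) : exists p : {linear V -> quotmod S},
  surj p /\ forall y, p y = 0 <-> y \in S.
Proof.
have lp : linear (fun x => \pi_(quotmod S) x : quotmod S).
  by move=> a x y; rewrite [LHS]raddfD; congr (_ + _); apply: pi_quotmod_scale.
exists (mklin lp); split=> [y|y]; first by exists (repr y); apply: reprK.
have e : (\pi_(quotmod S) y == \pi_(quotmod S) 0) = (y - 0 \in quot_pred S).
  by rewrite Quotient.idealrBE.
rewrite subr0 in e; split=> [y0|Sy].
  by change (is_true (y \in quot_pred S)); rewrite -e; apply/eqP; rewrite [RHS]raddf0.
by apply/eqP; rewrite -[0](raddf0 \pi_(quotmod S)) /= e.
Qed.

Lemma coker_proj U V (f : {linear U -> V}) : exists p : {linear V -> coker f},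
  surj p /\ forall y, p y = 0 <-> exists x, y = f x.
Proof.
have [p [ps pk]] := quotmod_proj (im_pred f); exists p; split=> // y.
by split=> [/pk/asboolP|yf]; [|apply/pk/asboolP].
Qed.

Lemma to_ker U V W (c : {linear U -> V}) (g : {linear W -> U}) :
  (forall x, c (g x) = 0) ->
  exists h : {linear W -> kermod c}, forall x, val (h x) = g x.
Proof.
move=> cg; have cgP x : g x \in ker_pred c by apply/eqP.
have lh : linear (fun x => KerMod (cgP x)).
  by move=> a x y; apply: val_inj; rewrite /= linearP.
by exists (mklin lh).
Qed.

Lemma kermodP U V (c : {linear U -> V}) (z : kermod c) : c (val z) = 0.
Proof. by case: z => x /= /eqP. Qed.

Definition projective P := forall U V (f : {linear U -> V}) (g : {linear P -> V}),
  surj f -> exists h : {linear P -> U}, forall x, f (h x) = g x.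

Lemma freeg_linear_eq (B : choiceType) U (f g : {linear {freeg B / R} -> U}) :
  (forall b, f << b >> = g << b >>) -> f =1 g.
Proof.
move=> fg D; rewrite -[D]freeg_sumE !raddf_sum; apply: eq_bigr => b _ /=.
have -> : << coeff b D *g b >> = coeff b D *: << b >> :> {freeg B / R}.
  by apply/eqP/freeg_eqP => x; rewrite coeffZ !coeffU mul1r.
by rewrite !linearZ /= fg.
Qed.

Lemma projective_freeg (B : choiceType) : projective {freeg B / R}.
Proof.
move=> U V f g /choice[s sP].
exists (flift (fun b => s (g << b >>))); pose fh := f \o flift (fun b => s (g << b >>)).
suff : fh =1 g by [].
have lfh : linear fh by move=> a x y; rewrite /fh /= !linearP.
apply: (@freeg_linear_eq _ _ (mklin lfh)) => b.
by rewrite /= /mklin /lin_fun /fh /= fliftE sP.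
Qed.

Lemma projective_cV p : projective 'cV[R]_p.
Proof.
move=> U V f g /choice[s sP].
have lh : linear (fun v : 'cV[R]_p => \sum_i v i 0 *: s (g (delta_mx i 0))).
  move=> a v w; rewrite scaler_sumr -big_split; apply: eq_bigr => i _ /=.
  by rewrite !mxE scalerDl scalerA.
exists (mklin lh) => v; rewrite /= [RHS](congr1 g (matrix_sum_delta v)).
rewrite /mklin /lin_fun !raddf_sum; apply: eq_bigr => i _ /=.
by rewrite big_ord1 !linearZ /= sP.
Qed.

(** The maps that become zero in the stable module category. [f] is a bare function since it is
    instantiated with differences such as [b (a x) - x]. *)
Definition thru_proj X Y (f : X -> Y) := exists Q, projective Q /\
  exists (u : {linear X -> Q}) (v : {linear Q -> Y}), forall x, f x = v (u x).

(** Isomorphism in the stable module category; it compares syzygies taken along different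
    surjections without the direct sums of Schanuel's lemma. *)
Definition stably_equiv X Y := exists (a : {linear X -> Y}) (b : {linear Y -> X}),
  thru_proj (fun x => b (a x) - x) /\ thru_proj (fun y => a (b y) - y).

Lemma thru_proj0 X Y (f : X -> Y) : (forall x, f x = 0) -> thru_proj f.
Proof.
move=> f0; exists 'cV[R]_0; split; first exact: projective_cV.
by exists (GRing.null_fun _ : {linear _ -> _}), (GRing.null_fun _ : {linear _ -> _}).
Qed.

Lemma stably_equiv_iso X Y : isomorphic X Y -> stably_equiv X Y.
Proof.
case=> f [g fg gf]; have lg : linear g.
  by move=> a x y; rewrite -{1}[x]gf -{1}[y]gf -linearP fg.
exists f, (mklin lg); split; apply: thru_proj0 => x /=.
  by rewrite [X in X - _]fg subrr.
by rewrite [X in X - _]gf subrr.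
Qed.

Lemma stably_equiv_refl X : stably_equiv X X.
Proof. by apply: stably_equiv_iso; exists idfun; exists id. Qed.

Lemma proj_lift_comp P U V W (f : {linear U -> V}) (g : {linear W -> V})
    (h : {linear P -> W}) : projective P -> surj f ->
  exists l : {linear P -> U}, forall x, f (l x) = g (h x).
Proof.
move=> pP sf; have lgh : linear (g \o h) by move=> a x y; rewrite /= !linearP.
exact: (pP _ _ f (mklin lgh) sf).
Qed.

Section Kernels.
Variables (X Y P Q : lmodType R) (c : {linear P -> X}) (d : {linear Q -> Y}).

Lemma restrict_ker (a : {linear X -> Y}) (al : {linear P -> Q}) :
  (forall x, d (al x) = a (c x)) ->
  exists ak : {linear kermod c -> kermod d}, forall z, val (ak z) = al (val z).
Proof.
move=> alP; have lv : linear (al \o val : kermod c -> Q).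
  by move=> r x y; rewrite /= !linearP.
by apply: (@to_ker _ _ _ d (mklin lv)) => z; rewrite /= [LHS]alP kermodP linear0.
Qed.

(* On [kermod c] the defect [b a - 1] is [h] restricted along the inclusion into
   [P]. *)
Lemma ker_defect (a : {linear X -> Y}) (b : {linear Y -> X})
    (al : {linear P -> Q}) (bl : {linear Q -> P}) :
  surj c -> (forall x, d (al x) = a (c x)) -> (forall y, c (bl y) = b (d y)) ->
  thru_proj (fun x => b (a x) - x) ->
  exists h : {linear P -> kermod c},
    forall z : kermod c, val (h (val z)) = bl (al (val z)) - val z.
Proof.
move=> sc alP blP [Z [pZ [u [v uvP]]]].
have [vl vlP] := pZ _ _ c v sc.
(* The correction [vl (u (c x))] moves the defect into [kermod c] for every [x] in [P]; it vanishes
   where [c x = 0]. *)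
have lg : linear (fun x => bl (al x) - x - vl (u (c x))).
  move=> r x y; rewrite [al _]linearP [bl _]linearP [c _]linearP [u _]linearP [vl _]linearP.
  by rewrite !scalerBr !opprD [X in X + _]addrACA [LHS]addrACA.
have [|h hP] := @to_ker _ _ _ c (mklin lg).
  by move=> x; rewrite /= /mklin /lin_fun !linearB /= blP alP vlP -uvP subrr.
by exists h => z; rewrite hP /= /mklin /lin_fun kermodP !linear0 addr0.
Qed.

End Kernels.

Lemma thru_ker X P (c : {linear P -> X}) (f : kermod c -> kermod c)
    (h : {linear P -> kermod c}) :
  projective P -> (forall z, f z = h (val z)) -> thru_proj f.
Proof.
by move=> pP fh; exists P; split=> //; exists (val : {linear kermod c -> P}), h.
Qed.

(** Syzygies are well defined on stable classes: lifts of [a] and [b] restrict to the kernels, where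
    their defects extend to [P] and [Q] and so factor through projectives. *)
Lemma stably_equiv_ker X Y P Q (c : {linear P -> X}) (d : {linear Q -> Y}) :
  projective P -> projective Q -> surj c -> surj d ->
  stably_equiv X Y -> stably_equiv (kermod c) (kermod d).
Proof.
move=> pP pQ sc sd [a [b [ba ab]]].
have [al alP] := proj_lift_comp a c pP sd.
have [bl blP] := proj_lift_comp b d pQ sc.
have [ak akP] := restrict_ker alP; have [bk bkP] := restrict_ker blP.
exists ak, bk; split.
  have [h hP] := ker_defect sc alP blP ba.
  apply: (thru_ker (h := h)) => // z; apply: val_inj.
  by rewrite hP raddfB /= bkP akP.
have [h hP] := ker_defect sd blP alP ab.
apply: (thru_ker (h := h)) => // z; apply: val_inj.
by rewrite hP raddfB /= akP bkP.
Qed.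


Definition hom_of U V (f : {linear U -> V}) : Hom U V :=
  MkHom (introT (asboolP (linear f)) (linearP f)).

(* [E] is the cokernel of the restriction [Hom(P, M) -> Hom(kermod c, M)]. *)
Definition is_ext1 X P (c : {linear P -> X}) M E :=
  exists f : {linear Hom (kermod c) M -> E}, surj f /\
    forall h, f h = 0 <-> exists k : {linear P -> M}, forall z, h z = k (val z).

Lemma iso_of_is_ext1 X P (c : {linear P -> X}) M E E' :
  is_ext1 c M E -> is_ext1 c M E' -> isomorphic E E'.
Proof.
move=> [f [fs fk]] [g [gs gk]]; apply: (iso_of_surj fs gs) => h.
by split=> [/fk/gk|/gk/fk].
Qed.

(** Ext^1 depends only on the stable class. Precomposition with [ak] maps [Hom (kermod d) M] to
    [Hom (kermod c) M]. It is onto modulo restrictions from [P] because the defect of [bk] after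
    [ak] extends to [P]; the other defect extends to [Q] and identifies the kernel. *)
Lemma is_ext1_transfer X Y P Q (c : {linear P -> X}) (d : {linear Q -> Y}) M E :
  projective P -> projective Q -> surj c -> surj d -> stably_equiv X Y ->
  is_ext1 c M E -> is_ext1 d M E.
Proof.
move=> pP pQ sc sd [a [b [ba ab]]] [f [fs fk]].
have [al alP] := proj_lift_comp a c pP sd.
have [bl blP] := proj_lift_comp b d pQ sc.
have [ak akP] := restrict_ker alP; have [bk bkP] := restrict_ker blP.
have [h hP] := ker_defect sc alP blP ba.
have [h' hP'] := ker_defect sd blP alP ab.
have comp_lin (U V W : lmodType R) (p : {linear U -> V}) (q : {linear V -> W}) :
  linear (q \o p) by move=> r x y; rewrite /= !linearP.
have lpre : linear (fun k : Hom (kermod d) M => hom_of (mklin (comp_lin _ _ _ ak k))).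
  by move=> r k k'; apply/val_inj/funext => z.
have fE k k' : f k = f k' <-> exists l : {linear P -> M}, forall z, k z = k' z + l (val z).
  split=> [fkk'|[l lP]].
    have /fk[l lP] : f (k - k') = 0 by rewrite linearB fkk' subrr.
    by exists l => z; rewrite -lP addrC subrK.
  apply/eqP; rewrite -subr_eq0 -linearB; apply/eqP/fk; exists l => z.
  by change (k z - k' z = l (val z)); rewrite lP addrC addKr.
exists (mklin (comp_lin _ _ _ (mklin lpre) f)); split=> [e|k].
  have [k kP] := fs e; exists (hom_of (mklin (comp_lin _ _ _ bk k))).
  rewrite -kP; apply/fE; exists (mklin (comp_lin _ _ _ h k)) => z.
  rewrite /= /mklin /lin_fun /= -raddfD; congr (k _); apply: val_inj.
  by rewrite raddfD /= hP bkP akP addrC subrK.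
split=> [/fk[l lP]|[l lP]]; last first.
  apply/fk; exists (mklin (comp_lin _ _ _ al l)) => z.
  by rewrite /= /mklin /lin_fun /= lP akP.
(* On [kermod d] the first term is [k (ak (bk z))] and the second is [k (ak (bk z) - z)], so the
   difference extends [k] to [Q]. *)
have lm : linear (fun q => l (bl q) - k (h' q)).
  by move=> r x y; rewrite [bl _]linearP [l _]linearP [h' _]linearP [k _]linearP
    scalerBr opprD [LHS]addrACA.
exists (mklin lm) => z; rewrite /= /mklin /lin_fun -bkP -lP /= /lin_fun /=.
rewrite -raddfB; congr (k _); apply: val_inj.
by rewrite raddfB /= hP' akP bkP opprB addrC subrK.
Qed.

Lemma stably_equiv_isor X Y Z : stably_equiv X Y -> isomorphic Y Z -> stably_equiv X Z.
Proof.
move=> [a [b [[Q [pQ [u [v uv]]]] [Q' [pQ' [u' [v' uv']]]]]]] [f [g fg gf]].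
have lg : linear g by move=> r x y; rewrite -{1}[x]gf -{1}[y]gf -linearP fg.
have comp_lin (U V W : lmodType R) (p : {linear U -> V}) (q : {linear V -> W}) :
  linear (q \o p) by move=> r x y; rewrite /= !linearP.
exists (mklin (comp_lin _ _ _ a f)), (mklin (comp_lin _ _ _ (mklin lg) b)); split.
  by exists Q; split=> //; exists u, v => x; rewrite -uv /= /mklin /lin_fun /= /lin_fun fg.
exists Q'; split=> //; exists (mklin (comp_lin _ _ _ (mklin lg) u')).
exists (mklin (comp_lin _ _ _ v' f)) => z.
by rewrite /= /mklin /lin_fun /= /lin_fun -uv' linearB gf.
Qed.

(** * Cocycles of the standard resolution as homomorphisms on syzygies *)

Section ExtOf.
Variables (L M H : lmodType R) (F : free_resolution L) (i : nat).
Variable phi : H -> {linear res_mod F i -> M}.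
Hypothesis phi_lin : forall r h h' x, phi (r *: h + h') x = r *: phi h x + phi h' x.
Hypothesis phi_cocycle : forall h x, phi h (res_diff F i x) = 0.
Hypothesis phi_onto : forall f : {linear res_mod F i -> M},
  (forall x, f (res_diff F i x) = 0) -> exists h, forall x, phi h x = f x.

Lemma cocycle_of_subproof h : hom_of (phi h) \in ker_pred (@cobound R L M F i).
Proof. by apply/eqP/val_inj/funext => x; apply: phi_cocycle. Qed.

Definition cocycle_of h : cocycle M F i := KerMod (cocycle_of_subproof h).

Lemma cocycle_of_linear : linear cocycle_of.
Proof. by move=> r h h'; apply/val_inj/val_inj/funext => x; apply: phi_lin. Qed.

(** Replaces the subtype of cocycles by a module [H]. In the applications [H] is [Hom Z M], where
    [Z] is the module covered by the free module of degree [i]. *)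
Lemma ext_of_cocycle : exists g : {linear H -> Ext_of M F i},
  surj g /\ forall h, g h = 0 <-> cocycle_of h \in @coboundary_pred R L M F i.
Proof.
have [p [ps pk]] := quotmod_proj (@coboundary_pred R L M F i).
have lg : linear (fun h => p (cocycle_of h)).
  by move=> r h h'; rewrite cocycle_of_linear linearP.
exists (mklin lg); split=> [e|h]; last exact: pk.
have [z <-] := ps e; have [|h hP] := @phi_onto (val z : Hom _ _).
  by move=> x; have := kermodP z => /(congr1 (fun f : Hom _ _ => f x)).
exists h; congr (p _); apply/val_inj/val_inj/funext; exact: hP.
Qed.

End ExtOf.

Lemma ext_of0 (L M H : lmodType R) (F : free_resolution L)
    (phi : H -> {linear res_mod F 0 -> M}) :
  (forall r h h' x, phi (r *: h + h') x = r *: phi h x + phi h' x) ->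
  (forall h x, phi h (res_diff F 0 x) = 0) ->
  (forall f : {linear res_mod F 0 -> M},
    (forall x, f (res_diff F 0 x) = 0) -> exists h, forall x, phi h x = f x) ->
  exists g : {linear H -> Ext_of M F 0},
    surj g /\ forall h, g h = 0 <-> forall x, phi h x = 0.
Proof.
move=> pl pc po; have [g [gs gk]] := ext_of_cocycle pl pc po.
exists g; split=> // h; split=> [/gk/eqP h0 x|h0].
  exact: (congr1 (fun f : Hom _ _ => f x) h0).
by apply/gk/eqP/val_inj/funext.
Qed.

Lemma ext_ofS (L M H : lmodType R) (F : free_resolution L) i
    (phi : H -> {linear res_mod F i.+1 -> M}) :
  (forall r h h' x, phi (r *: h + h') x = r *: phi h x + phi h' x) ->
  (forall h x, phi h (res_diff F i.+1 x) = 0) ->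
  (forall f : {linear res_mod F i.+1 -> M},
    (forall x, f (res_diff F i.+1 x) = 0) -> exists h, forall x, phi h x = f x) ->
  exists g : {linear H -> Ext_of M F i.+1},
    surj g /\ forall h, g h = 0 <->
      exists k : {linear res_mod F i -> M}, forall x, phi h x = k (res_diff F i x).
Proof.
move=> pl pc po; have [g [gs gk]] := ext_of_cocycle pl pc po.
exists g; split=> // h; split=> [/gk/asboolP[k kP]|[k kP]].
  by exists k => x; apply: (congr1 (fun f : Hom _ _ => f x) kP).
by apply/gk/asboolP; exists (hom_of k); apply/val_inj/funext.
Qed.

Section StdCover.
Variables (Z M : lmodType R).
Let c : {linear {freeg Z / R} -> Z} := @cover R Z.

Lemma comp_cover_linear (h : Hom Z M) : linear (h \o c).
Proof. by move=> r x y; rewrite /= !linearP. Qed.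

Definition comp_cover h : {linear {freeg Z / R} -> M} := mklin (comp_cover_linear h).

Lemma comp_cover_onto (f : {linear {freeg Z / R} -> M}) :
  (forall x, cover x = 0 -> f x = 0) -> exists h, forall x, comp_cover h x = f x.
Proof.
move=> f0; have cs : surj c := @cover_surj R Z.
have /choice[s sP] := cs.
have fE x x' : c x = c x' -> f x = f x'.
  move=> /eqP; rewrite -subr_eq0 -linearB => /eqP/f0/eqP.
  by rewrite linearB subr_eq0 => /eqP.
have ls : linear (f \o s).
  by move=> r x y; rewrite /= -linearP; apply: fE; rewrite linearP !sP.
exists (hom_of (mklin ls)) => x; rewrite /= /mklin /lin_fun /=.
by apply: fE; rewrite sP.
Qed.

End StdCover.

Lemma ext0_hom (L M : lmodType R) : exists g : {linear Hom L M -> Ext 0 L M},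
  surj g /\ forall h, g h = 0 <-> forall x, h x = 0.
Proof.
have [|h x|f f0|g [gs gk]] := @ext_of0 L M _ (std_resolution L) (@comp_cover L M).
- by [].
- have e : cover (@std_diff R L 0 x) = 0 :> L.
    by apply/(@std_exact_cover R L 0); exists x.
  exact: etrans (congr1 h e) (linear0 h).
- by apply: comp_cover_onto => x /(@std_exact_cover R L 0)[y ->]; apply: f0.
exists g; split=> // h; rewrite gk; split=> h0 x.
  by have [y <-] := @cover_surj R L x; apply: h0.
exact: h0.
Qed.

(** Dimension shifting read off the resolution: a cocycle of degree [i.+1] is a homomorphism on the
    [i.+1]-st syzygy, and the coboundaries are those that extend to the free module containing
    it. *)
Lemma ext_is_ext1 (L M : lmodType R) i :
  is_ext1 (@cover R (iter i (@syz R) L)) M (Ext i.+1 L M).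
Proof.
have [|h x|f f0|g [gs gk]] := @ext_ofS L M _ (std_resolution L) i
  (@comp_cover (iter i.+1 (@syz R) L) M).
- by [].
- have e : cover (@std_diff R L i.+1 x) = 0 :> iter i.+1 (@syz R) L.
    by apply/(@std_exact_cover R L i.+1); exists x.
  exact: etrans (congr1 h e) (linear0 h).
- by apply: comp_cover_onto => x /(@std_exact_cover R L i.+1)[y ->]; apply: f0.
exists g; split=> // h; apply: (iff_trans (gk h)).
split=> [[k kP]|[k kP]]; exists k => x.
  by have [y <-] := @cover_surj R _ x; apply: kP.
exact: kP.
Qed.

(** The standard syzygies of [L], taken one step further, stay stably equivalent to those of [L'].
    The shift starts at degree 2, because Ext^1 of [L] is only a quotient of [Hom L' M]. *)
Lemma ext_shift (L L' : lmodType R) P (c : {linear P -> L}) M i :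
  projective P -> surj c ->
  isomorphic (kermod c) L' -> isomorphic (Ext i.+2 L M) (Ext i.+1 L' M).
Proof.
move=> pP sc cL'.
have st : stably_equiv (iter i.+1 (@syz R) L) (iter i (@syz R) L').
  elim: i => [|i IHi].
    apply: stably_equiv_isor cL'; apply: stably_equiv_ker => //.
    - exact: projective_freeg.
    - exact: cover_surj.
    - exact: stably_equiv_refl.
  by apply: stably_equiv_ker => //;
    [exact: projective_freeg..|exact: cover_surj|exact: cover_surj].
apply: iso_of_is_ext1 (ext_is_ext1 L' M i).
apply: is_ext1_transfer st (ext_is_ext1 L M i.+1);
  [exact: projective_freeg..|exact: cover_surj|exact: cover_surj].
Qed.

Lemma linear_mulmx p a (l : {linear 'cV[R]_p -> 'cV[R]_a}) :
  exists X : 'M_(a, p), forall y, l y = X *m y.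
Proof.
exists (\matrix_(i, j) l (delta_mx j 0) i 0) => y; apply/colP => i.
rewrite {1}[y]matrix_sum_delta raddf_sum summxE mxE; apply: eq_bigr => j _.
by rewrite big_ord1 /= linearZ !mxE mulrC.
Qed.

(** * Ext^0 and Ext^1 as homology of matrix complexes *)

Section MatrixDescription.
Variables (a b r0 r1 r2 : nat) (D' : 'M[R]_(r0, r1)) (D : 'M[R]_(r1, r2)).
Variable Q : 'M[R]_(a, b).

(** The witness [Y] turns vanishing in [coker Q] into a linear equation in [X] and [Y]. *)
Definition mx_cocycle (X : 'M[R]_(a, r1)) := exists Y : 'M_(b, r2), X *m D = Q *m Y.

(* [E] is the homology of [Hom(R^r0, M) -> Hom(R^r1, M) -> Hom(R^r2, M)] for
   [M = coker Q], computed with representatives in [Hom(R^r1, R^a)]. *)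
Definition mx_homology E := exists f : 'M[R]_(a, r1) -> E,
  [/\ forall c (X X' : 'M_(a, r1)), mx_cocycle X -> mx_cocycle X' ->
        f (c *: X + X') = c *: f X + f X',
      forall e, exists2 X : 'M_(a, r1), mx_cocycle X & f X = e
    & forall X : 'M_(a, r1), mx_cocycle X ->
        (f X = 0 <-> exists (Z : 'M_(a, r0)) (W : 'M_(b, r1)), X = Z *m D' + Q *m W)].

Variables (M : lmodType R) (q : {linear 'cV[R]_a -> M}).
Hypotheses (qs : surj q) (qk : forall x, q x = 0 <-> exists z, x = Q *m z).

Lemma q_mulmx0 p (A : 'M[R]_(a, p)) : (forall y : 'cV_p, q (A *m y) = 0) ->
  exists Y : 'M_(b, p), A = Q *m Y.
Proof.
move=> A0; have /choice[y yP] : forall j, exists y, col j A = Q *m y.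
  by move=> j; apply/qk; rewrite colE.
exists (\matrix_(i, j) y j i 0); apply/matrixP => i j.
have := congr1 (fun v : 'cV_a => v i 0) (yP j); rewrite !mxE => ->.
by apply: eq_bigr => l _; rewrite !mxE.
Qed.

Lemma q_lift p (k : {linear 'cV[R]_p -> M}) :
  exists X : 'M[R]_(a, p), forall y, q (X *m y) = k y.
Proof.
have [l lP] := @projective_cV p _ _ q k qs; have [X XP] := linear_mulmx l.
by exists X => y; rewrite -XP.
Qed.

(** [Hom U M] with [U = coker D] stands for the cocycles: a homomorphism lifts to a matrix since
    free modules are projective, and a cocycle matrix descends to [U]. *)
Lemma mx_homologyI U (d : {linear 'cV[R]_r1 -> U}) E (g : {linear Hom U M -> E}) :
  surj d -> (forall x, d x = 0 <-> exists z, x = D *m z) -> surj g ->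
  (forall h, g h = 0 <->
     exists Z : 'M[R]_(a, r0), forall y, h (d y) = q (Z *m D' *m y)) ->
  mx_homology E.
Proof.
move=> ds dk gs gk.
have /choice[f fP] : forall X : 'M[R]_(a, r1), exists e, mx_cocycle X ->
    exists h : Hom U M, (forall y, h (d y) = q (X *m y)) /\ e = g h.
  move=> X; have [[Y XD]|nX] := pselect (mx_cocycle X); last by exists 0.
  have /choice[s sP] := ds.
  have hE y y' : d y = d y' -> q (X *m y) = q (X *m y').
    move=> /eqP; rewrite -subr_eq0 -linearB => /eqP/dk[z zP].
    apply/eqP; rewrite -subr_eq0 -linearB -mulmxBr zP mulmxA XD -mulmxA.
    by apply/eqP/qk; exists (Y *m z).
  have lh : linear (fun u => q (X *m s u)).
    move=> c u v; rewrite -linearP scalemxAr -mulmxDr.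
    by apply: hE; rewrite linearP !sP.
  exists (g (hom_of (mklin lh))) => _; exists (hom_of (mklin lh)); split=> // y.
  by rewrite /= /mklin /lin_fun; apply: hE; rewrite sP.
exists f; split=> [c X X' cX cX'|e|X cX].
- have cXX : mx_cocycle (c *: X + X').
    have [Y XD] := cX; have [Y' XD'] := cX'; exists (c *: Y + Y').
    by rewrite mulmxDl mulmxDr -scalemxAl -scalemxAr XD XD'.
  have [h [hP ->]] := fP _ cX; have [h' [hP' ->]] := fP _ cX'.
  have [h2 [h2P ->]] := fP _ cXX; rewrite -linearP; congr (g _).
  apply/val_inj/funext => u; have [y <-] := ds u.
  apply: etrans (h2P y) _; apply/esym.
  apply: etrans (_ : c *: h (d y) + h' (d y) = _) => //.
  by rewrite hP hP' -linearP mulmxDl scalemxAl.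
- have [h <-] := gs e.
  have lhd : linear (h \o d) by move=> c x y; rewrite /= !linearP.
  have [X XP] := q_lift (mklin lhd).
  have cX : mx_cocycle X.
    apply: q_mulmx0 => y; rewrite -mulmxA XP.
    have dDy : d (D *m y) = 0 by apply/dk; exists y.
    exact: etrans (congr1 h dDy) (linear0 h).
  exists X => //; have [h' [hP' ->]] := fP _ cX; congr (g _).
  apply/val_inj/funext => u; have [y <-] := ds u.
  by apply: etrans (hP' y) _; rewrite XP.
have [h [hP ->]] := fP _ cX; split=> [/gk[Z ZP]|[Z [W XE]]].
  have [|W WP] := @q_mulmx0 _ (X - Z *m D').
    by move=> y; rewrite mulmxBl linearB /= -hP ZP subrr.
  by exists Z, W; rewrite -WP addrC subrK.
apply/gk; exists Z => y; rewrite hP XE mulmxDl linearD.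
suff -> : q (Q *m W *m y) = 0 by rewrite addr0.
by apply/qk; exists (W *m y); rewrite mulmxA.
Qed.

End MatrixDescription.

Section ExtMatrix.
Variables (L M : lmodType R) (a b p0 p1 : nat).
Variables (Q : 'M[R]_(a, b)) (D0 : 'M[R]_(p0, p1)).
Variables (q : {linear 'cV[R]_a -> M}) (c : {linear 'cV[R]_p0 -> L}).
Hypotheses (qs : surj q) (qk : forall x, q x = 0 <-> exists z, x = Q *m z).
Hypotheses (cs : surj c) (ck : forall x, c x = 0 <-> exists z, x = D0 *m z).

Lemma ext0_matrix : mx_homology (0 : 'M_(0, p0)) D0 Q (Ext 0 L M).
Proof.
have [g [gs gk]] := ext0_hom L M.
apply: (mx_homologyI qs qk cs ck gs) => h; split=> [/gk h0|[Z hZ]].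
  by exists 0 => y; rewrite h0 mulmx0 mul0mx linear0.
by apply/gk => x; have [y <-] := cs x; rewrite hZ mulmx0 mul0mx linear0.
Qed.

Variables (p2 : nat) (D1 : 'M[R]_(p1, p2)).
Hypothesis D01 : forall x : 'cV_p1, D0 *m x = 0 <-> exists z, x = D1 *m z.

Lemma ker_cover : exists d : {linear 'cV[R]_p1 -> kermod c},
  [/\ forall y, val (d y) = D0 *m y, surj d
    & forall x, d x = 0 <-> exists z, x = D1 *m z].
Proof.
have l0 : linear (fun y : 'cV_p1 => D0 *m y) by move=> r x y; rewrite mulmxDr -scalemxAr.
have [|d dP] := @to_ker _ _ _ c (mklin l0) => [x|].
  by apply/ck; exists x.
exists d; split=> // [z|x].
  have /ck[y yP] := kermodP z; exists y; apply: val_inj; rewrite dP.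
  exact/esym.
rewrite -D01; split=> [dx|D0x]; first by rewrite -[D0 *m x]dP dx.
by apply: val_inj; rewrite dP.
Qed.

(** The standard cover and [c] are surjections from projectives onto the same [L], so [c] computes
    Ext^1 as well; its kernel is the cokernel of [D1]. *)
Lemma ext1_matrix : mx_homology D0 D1 Q (Ext 1 L M).
Proof.
have [g [gs gk]] : is_ext1 c M (Ext 1 L M).
  apply: is_ext1_transfer (ext_is_ext1 L M 0) => //.
  - exact: projective_freeg.
  - exact: projective_cV.
  - exact: cover_surj.
  - exact: stably_equiv_refl.
have [d [dE ds dk]] := ker_cover.
apply: (mx_homologyI qs qk ds dk gs) => h; split=> [/gk[k kP]|[Z hZ]].
  have [Z ZP] := q_lift qs k.
  by exists Z => y; rewrite kP dE -mulmxA ZP.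
apply/gk; have lZ : linear (fun v => q (Z *m v)).
  by move=> r x y; rewrite mulmxDr -scalemxAr linearP.
exists (mklin lZ) => z; have [y <-] := ds z.
by rewrite hZ /mklin /lin_fun dE -[RHS]/(q (Z *m (D0 *m y))) mulmxA.
Qed.

Lemma ext_shift_matrix i (L' : lmodType R) (c' : {linear 'cV[R]_p1 -> L'}) :
  surj c' -> (forall x, c' x = 0 <-> exists z, x = D1 *m z) ->
  isomorphic (Ext i.+2 L M) (Ext i.+1 L' M).
Proof.
move=> cs' ck'; have [d [dE ds dk]] := ker_cover.
apply: ext_shift (projective_cV (p := p0)) cs _.
by apply: (iso_of_surj ds cs') => x; split=> [/dk/ck'|/ck'/dk].
Qed.

End ExtMatrix.

End Modules.

(** * Groebner bases and splittings *)

Section Dickson.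
Variable n : nat.

(** Induction on the number [k] of compared coordinates. If the next coordinate of [e] reaches its
    maximum [M] over the list [l0], some member of [l0] lies below [e]; each smaller value gives a
    slice where this coordinate is constant. *)
Lemma dickson_below (k : nat) (E : 'X_{1..n} -> Prop) :
  exists l : seq 'X_{1..n}, (forall d, d \in l -> E d) /\
    forall e, E e ->
      exists2 d, d \in l & forall i : 'I_n, (i < k)%N -> (d i <= e i)%N.
Proof.
elim: k E => [|k IHk] E.
  have [[e Ee]|nE] := pselect (exists e, E e); last first.
    by exists [::]; split=> // e Ee; case: nE; exists e.
  by exists [:: e]; split=> [d|d _]; [rewrite inE => /eqP-> | exists e; rewrite ?inE].
have [kn|nk] := ltnP k n; last first.
  have [l [lE El]] := IHk E; exists l; split=> // e /El[d dl de]; exists d => // i _.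
  by apply: de; apply: leq_trans nk.
pose j := Ordinal kn; have [l0 [l0E El0]] := IHk E.
have /choice[l lP] : forall v, exists l, _ := fun v => IHk (fun e => E e /\ e j = v).
pose M := (\max_(d <- l0) d j)%N.
exists (l0 ++ flatten [seq l v | v <- iota 0 M]); split=> [d|e Ee].
  rewrite mem_cat => /orP[/l0E//|/flattenP[_ /mapP[v _ ->] dv]].
  by have [/(_ _ dv)[]] := lP v.
have [Me|eM] := leqP M (e j).
  have [d dl de] := El0 _ Ee; exists d; first by rewrite mem_cat dl.
  move=> i; rewrite ltnS leq_eqVlt => /orP[/eqP ik|/de//].
  have -> : i = j by apply: val_inj.
  by apply: leq_trans Me; rewrite /M (big_rem d) //= leq_maxl.
have [lE El] := lP (e j); have [//|d dl de] := El e.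
exists d; first by rewrite mem_cat; apply/orP; right; apply/flattenP;
  exists (l (e j)); rewrite // map_f // mem_iota.
move=> i; rewrite ltnS leq_eqVlt => /orP[/eqP ik|/de//].
have -> : i = j by apply: val_inj.
by have [_ ->] := lE _ dl.
Qed.

Lemma dickson (E : 'X_{1..n} -> Prop) :
  exists l : seq 'X_{1..n}, (forall d, d \in l -> E d) /\
    forall e, E e -> exists2 d, d \in l & (d <= e)%MM.
Proof.
have [l [lE El]] := dickson_below n E; exists l; split=> // e /El[d dl de].
by exists d => //; apply/mnm_lepP => i; apply: de.
Qed.

End Dickson.

Section LinearExtension.
Variables (n : nat) (F : comNzRingType) (V : lmodType {mpoly F[n]}).
Implicit Types (v : 'X_{1..n} -> V) (f g : {mpoly F[n]}).

(** The map linear over [F] with prescribed, unrelated values on monomials; constants act through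
    [%:MP] because [V] is a module over the polynomial ring. *)
Definition lext v f : V := \sum_(m <- msupp f) (f@_m)%:MP *: v m.

Lemma lextE v f k : (msize f <= k)%N ->
  lext v f = \sum_(m : 'X_{1..n < k}) (f@_m)%:MP *: v m.
Proof.
move=> fk; pose I : subFinType _ := 'X_{1..n < k}.
rewrite /lext (big_mksub I) ?msupp_uniq //=; last first.
  by move=> m /msize_mdeg_lt /leq_trans; apply.
rewrite big_rmcond //= => m /memN_msupp_eq0 ->.
by rewrite mpolyC0 scale0r.
Qed.

Lemma lextD v : {morph lext v : f g / f + g}.
Proof.
move=> f g; pose k := maxn (msize (f + g)) (maxn (msize f) (msize g)).
rewrite !(@lextE _ _ k) ?leq_max ?leqnn ?orbT // -big_split /=.
by apply: eq_bigr => m _; rewrite mcoeffD mpolyCD scalerDl.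
Qed.

Lemma lextZ v c f : lext v (c *: f) = c%:MP *: lext v f.
Proof.
pose k := maxn (msize (c *: f)) (msize f).
rewrite !(@lextE _ _ k) ?leq_max ?leqnn ?orbT // scaler_sumr.
by apply: eq_bigr => m _; rewrite mcoeffZ mpolyCM scalerA.
Qed.

Lemma lextX v m : lext v 'X_[m] = v m.
Proof. by rewrite /lext msuppX big_seq1 mcoeffX eqxx scale1r. Qed.

End LinearExtension.

Section Groebner.
Variables (n : nat) (F : fieldType).
Local Notation R := {mpoly F[n]}.

Definition over (O : {pred F}) p q (A : 'M[R]_(p, q)) :=
  forall i j, A i j \in mpolyOver n O.

(** Being defined over the subring generated by [D]. Later the subring is instantiated with the
    coefficients regular at a point. *)
Definition over_span (D : seq F) p q (A : 'M[R]_(p, q)) :=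
  forall O : subringClosed F, {subset D <= O} -> over O A.

Definition mxcoefs p q (A : 'M[R]_(p, q)) : seq F :=
  flatten [seq [seq (A ij.1 ij.2)@_m | m <- msupp (A ij.1 ij.2)] |
           ij : 'I_p * 'I_q].

Lemma mxcoefsP p q (A : 'M[R]_(p, q)) (D : seq F) :
  {subset mxcoefs A <= D} -> over_span D A.
Proof.
move=> AD O DO i j; apply/mpolyOverP => m.
have [->|Am] := eqVneq (A i j)@_m 0; first exact: rpred0.
apply/DO/AD/flattenP; exists [seq (A i j)@_m | m <- msupp (A i j)].
  by apply/mapP; exists (i, j); rewrite ?mem_enum.
by apply/map_f; rewrite mcoeff_msupp.
Qed.

Section Over.
Variable O : subringClosed F.

Lemma over0 p q : over O (0 : 'M_(p, q)).
Proof. by move=> i j; rewrite mxE rpred0. Qed.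

Lemma overD p q (A B : 'M_(p, q)) : over O A -> over O B -> over O (A + B).
Proof. by move=> oA oB i j; rewrite mxE rpredD. Qed.

Lemma overN p q (A : 'M_(p, q)) : over O A -> over O (- A).
Proof. by move=> oA i j; rewrite mxE rpredN. Qed.

Lemma overB p q (A B : 'M_(p, q)) : over O A -> over O B -> over O (A - B).
Proof. by move=> oA oB; apply/overD/overN. Qed.

Lemma overZ p q a (A : 'M_(p, q)) :
  a \in mpolyOver n O -> over O A -> over O (a *: A).
Proof. by move=> oa oA i j; rewrite mxE rpredM. Qed.

Lemma overM p q r (A : 'M_(p, q)) (B : 'M_(q, r)) :
  over O A -> over O B -> over O (A *m B).
Proof. by move=> oA oB i j; rewrite mxE rpred_sum // => l _; rewrite rpredM. Qed.

Lemma over_lext q (v : 'X_{1..n} -> 'rV_q) f :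
  f \in mpolyOver n O -> (forall m, m \in msupp f -> over O (v m)) ->
  over O (lext v f).
Proof.
move=> /mpolyOverP of_ ov i j; rewrite /lext summxE big_seq rpred_sum // => m mf.
by rewrite mxE rpredM ?mpolyOverC // ov.
Qed.

End Over.

(** Dickson's lemma for leading monomials. The elements are made monic so that division by them
    creates no denominators. *)
Lemma ideal_groebner (I : R -> Prop) : (forall a f, I f -> I (a * f)) ->
  exists gs : seq R, (forall g, g \in gs -> I g /\ mleadc g = 1) /\
    forall f, I f -> f != 0 -> exists2 g, g \in gs & (mlead g <= mlead f)%MM.
Proof.
move=> IM.
have [l [lE El]] :=
  dickson (fun m => exists f, [/\ I f, mleadc f = 1 & mlead f = m]).
have /choice[h hP] : forall m, exists f, m \in l ->
    [/\ I f, mleadc f = 1 & mlead f = m].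
  by move=> m; have [/lE[f fP]|ml] := boolP (m \in l); [exists f | exists 0].
exists (map h l); split=> [_ /mapP[m ml ->]|f If f0]; first by have [] := hP _ ml.
have c0 : mleadc f != 0 by rewrite mleadc_eq0.
have lf : mlead ((mleadc f)^-1 *: f) = mlead f by rewrite mleadZ ?invr_eq0.
have [|d dl df] := El (mlead f).
  exists ((mleadc f)^-1 *: f); split=> //; first by rewrite -mul_mpolyC; apply: IM.
  by rewrite lf mcoeffZ mulVf.
by exists (h d); [apply: map_f | have [_ _ ->] := hP _ dl].
Qed.

Definition reduced_wrt (gs : seq R) (f : R) :=
  forall g m, g \in gs -> (mlead g <= m)%MM -> f@_m = 0.

Lemma lead_shift_lt (g : R) m m' : mleadc g = 1 -> (mlead g <= m)%MM ->
  m' \in msupp ('X_[m - mlead g] * g - 'X_[m]) -> (m' < m)%O.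
Proof.
move=> g1 gm; have g0 : g != 0 by rewrite -mleadc_eq0 g1 oner_eq0.
have lm : mlead ('X_[m - mlead g] * g) = m.
  by rewrite mleadM ?mleadXm ?submK // -mleadc_eq0 mleadXm mcoeffX eqxx oner_eq0.
rewrite mcoeff_msupp mcoeffB mcoeffX => nz; rewrite lt_neqAle.
have [mm'|nm] /= := eqVneq m' m.
  have := mcoeffMX g (m - mlead g) (mlead g); rewrite submK // g1 mulrC => e.
  by move: nz; rewrite mm' eqxx e subrr eqxx.
move: nz; rewrite [m == m']eq_sym (negPf nm) subr0 -mcoeff_msupp.
by move/msupp_le_mlead; rewrite lm.
Qed.

Definition const_linear p q (s : 'rV[R]_p -> 'rV[R]_q) :=
  {morph s : u v / u + v} /\ forall c u, s (c%:MP *: u) = c%:MP *: s u.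

Definition preserves_over (D : seq F) p q (s : 'rV[R]_p -> 'rV[R]_q) :=
  forall O : subringClosed F, {subset D <= O} -> forall u, over O u -> over O (s u).

(* [s 'X_[d] = v d] is chosen such that ['X_[d] - v d b] is reduced with respect to
   a Groebner basis of the ideal [I] of the [u b]; a reduced element of [I] is 0. *)
Lemma split_col r (b : 'cV[R]_r) :
  exists (s : 'rV_1 -> 'rV_r) (D : seq F), [/\ const_linear s, preserves_over D s
    & forall u : 'rV_r, s (u *m b) *m b = u *m b].
Proof.
pose I f := exists u : 'rV_r, f = (u *m b) 0 0.
have IM a f : I f -> I (a * f).
  by case=> u ->; exists (a *: u); rewrite -scalemxAl [RHS]mxE.
have [gs [gsI Igs]] := ideal_groebner IM.
have /choice[c cP] : forall g, exists u : 'rV_r, g \in gs -> g = (u *m b) 0 0.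
  move=> g; have [/gsI[[u gu] _]|_] := boolP (g \in gs); last by exists 0.
  by exists u.
(* The list is fixed before any monomial is reduced. The recursion only multiplies and subtracts, so
   every [v m] stays over the subring generated by [D]. *)
pose D := flatten [seq mxcoefs (c g) | g <- gs] ++
          flatten [seq mxcoefs (const_mx g : 'M_1) | g <- gs].
have Dc g : g \in gs -> over_span D (c g).
  move=> ggs; apply/mxcoefsP => x xc; rewrite /D mem_cat; apply/orP; left.
  by apply/flattenP; exists (mxcoefs (c g)) => //; apply: (map_f (fun g => mxcoefs (c g))).
have Dg g : g \in gs -> forall O : subringClosed F, {subset D <= O} ->
    g \in mpolyOver n O.
  move=> ggs O DO; suff /(_ O DO 0 0) : over_span D (const_mx g : 'M_1) by rewrite mxE.
  apply/mxcoefsP => x xc; rewrite /D mem_cat; apply/orP; right.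
  by apply/flattenP; exists (mxcoefs (const_mx g : 'M_1)) => //;
    apply: (map_f (fun g => mxcoefs (const_mx g : 'M_1))).
have /choice[v vP] : forall m, exists v : 'rV_r, over_span D v /\
    reduced_wrt gs ('X_[m] - (v *m b) 0 0).
  apply: ltmwf => m IH.
  have [[g ggs gm]|ng] := pselect (exists2 g, g \in gs & (mlead g <= m)%MM); last first.
    exists 0; split=> [O _|g m' ggs gm']; first exact: over0.
    rewrite mul0mx mxE subr0 mcoeffX; case: eqP => // mm'.
    by case: ng; exists g; rewrite ?mm'.
  pose rest := 'X_[m - mlead g] * g - 'X_[m].
  have /choice[w wP] : forall m', exists v : 'rV_r, (m' < m)%O -> over_span D v /\
      reduced_wrt gs ('X_[m'] - (v *m b) 0 0).
    move=> m'; case: (boolP (m' < m)%O) => [/IH[v vP]|]; last by exists 0.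
    by exists v.
  have restlt m' : m' \in msupp rest -> (m' < m)%O.
    by apply: lead_shift_lt => //; have [] := gsI _ ggs.
  (* ['X_[m]] is a multiple of [g] minus [rest]. The cofactors [c g] account for the multiple and
     the recursive values [w] for [rest], so the new remainder combines remainders that are already
     reduced. *)
  exists ('X_[m - mlead g] *: c g - lext w rest); split=> [O DO|].
    apply: overB; first by apply: overZ; [apply: mpolyOverX | apply: Dc].
    apply: over_lext => [|m' /restlt /wP[ow _]]; last exact: ow.
    by rewrite rpredB ?rpredM ?mpolyOverX ?Dg.
  have lextb : (lext w rest *m b) 0 0 =
      \sum_(m' <- msupp rest) rest@_m' *: (w m' *m b) 0 0.
    rewrite /lext mulmx_suml summxE; apply: eq_bigr => m' _.
    by rewrite -scalemxAl mxE mul_mpolyC.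
  have -> : 'X_[m] - (('X_[m - mlead g] *: c g - lext w rest) *m b) 0 0 =
      - \sum_(m' <- msupp rest) rest@_m' *: ('X_[m'] - (w m' *m b) 0 0).
    rewrite mulmxBl [in LHS]mxE -scalemxAl [in LHS]mxE -cP // [in LHS]mxE lextb.
    under [in RHS]eq_bigr do rewrite scalerBr.
    by rewrite sumrB -mpolyE /rest; ring.
  move=> g' m' g's g'm; rewrite mcoeffN big_seq raddf_sum big1 ?oppr0 //= => m'' m''s.
  by have [_ /(_ g' m' g's g'm)] := wP _ (restlt _ m''s); rewrite mcoeffZ => ->; rewrite mulr0.
exists (fun u => lext v (u 0 0)), D; split.
- by split=> [u u'|a u]; rewrite !mxE ?lextD // mul_mpolyC lextZ.
- by move=> O DO u uO; apply: over_lext => // m _; have [+ _] := vP m; apply.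
move=> u; pose f := (u *m b) 0 0.
have lextb : (lext v f *m b) 0 0 = \sum_(m <- msupp f) f@_m *: (v m *m b) 0 0.
  rewrite /lext mulmx_suml summxE; apply: eq_bigr => m' _.
  by rewrite -scalemxAl mxE mul_mpolyC.
apply/rowP => j; rewrite !ord1 /=; suff fE : f = (lext v f *m b) 0 0 by rewrite -[LHS]fE.
apply/eqP; rewrite -subr_eq0.
pose d := f - (lext v f *m b) 0 0; rewrite -/d.
have Id : I d by exists (u - lext v f); rewrite mulmxBl [RHS]mxE [X in _ + X]mxE.
have dred : reduced_wrt gs d.
  have -> : d = \sum_(m <- msupp f) f@_m *: ('X_[m] - (v m *m b) 0 0).
    under eq_bigr do rewrite scalerBr.
    by rewrite sumrB -mpolyE -lextb.
  move=> g m ggs gm; rewrite raddf_sum big1 //= => m' _.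
  by have [_ /(_ g m ggs gm)] := vP m'; rewrite mcoeffZ => ->; rewrite mulr0.
have [//|d0] := eqVneq d 0.
have [g ggs gd] := Igs _ Id d0.
by have /eqP := dred _ _ ggs gd; rewrite mleadc_eq0 (negPf d0).
Qed.

Lemma ideal_fg (I : R -> Prop) : I 0 -> (forall f g, I f -> I g -> I (f + g)) ->
    (forall a f, I f -> I (a * f)) ->
  exists s (g : 'cV[R]_s), (forall i, I (g i 0)) /\
    forall f, I f -> exists z : 'rV_s, f = (z *m g) 0 0.
Proof.
move=> I0 ID IM; have [gs [gsI Igs]] := ideal_groebner IM.
exists (size gs), (\col_i gs`_i); split=> [i|f].
  by rewrite mxE; have [] := gsI gs`_i (mem_nth _ (ltn_ord i)).
move: {2}(mlead f) (erefl (mlead f)) => m fm; move: m f fm.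
apply: ltmwf => m IH f fm If.
have [->|f0] := eqVneq f 0; first by exists 0; rewrite mul0mx mxE.
have [g ggs gf] := Igs _ If f0; have [Ig g1] := gsI _ ggs.
have [i gi] : exists i : 'I_(size gs), g = gs`_i.
  by have lt := ggs; rewrite -index_mem in lt; exists (Ordinal lt); rewrite /= nth_index.
pose a := mleadc f *: 'X_[m - mlead g]; pose f' := f - a * g.
have If' : I f' by apply: ID => //; rewrite -mulN1r mulrA; apply: IM.
have [f'0|f'0] := eqVneq f' 0; last first.
  have g0 : g != 0 by rewrite -mleadc_eq0 g1 oner_eq0.
  have lf' : (mlead f' < m)%O.
    have c0 : mleadc f != 0 by rewrite mleadc_eq0.
    have x0 : 'X_[m - mlead g] != 0 :> R.
      by rewrite -mleadc_eq0 mleadXm mcoeffX eqxx oner_eq0.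
    have la : mlead (a * g) = m.
      by rewrite /a -scalerAl mleadZ // mleadM // mleadXm submK // -fm.
    rewrite lt_neqAle; apply/andP; split; last first.
      by apply: le_trans (mleadB_le _ _) _; rewrite la fm joinxx.
    apply: contraNneq f'0 => lm; rewrite -mleadc_eq0 lm mcoeffB /a -scalerAl mcoeffZ.
    have := mcoeffMX g (m - mlead g) (mlead g); rewrite submK -?fm // g1 mulrC fm => ->.
    by rewrite mulr1 subrr.
  have [z fz] := IH _ lf' f' erefl If'.
  exists (z + a *: delta_mx 0 i); rewrite mulmxDl [RHS]mxE -fz -scalemxAl -rowE !mxE.
  by rewrite -gi subrK.
exists (a *: delta_mx 0 i); rewrite -scalemxAl -rowE !mxE -gi.
by apply/eqP; rewrite -subr_eq0 -/f' f'0.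
Qed.

(** Induction on [p]: generators of the ideal of first coordinates are lifted to [N] and joined with
    generators of the part of [N] with first coordinate 0. *)
Lemma submodule_fg p (N : 'rV[R]_p -> Prop) : N 0 ->
    (forall u v, N u -> N v -> N (u + v)) -> (forall a u, N u -> N (a *: u)) ->
  exists s (G : 'M[R]_(s, p)), forall u, N u <-> exists z, u = z *m G.
Proof.
elim: p N => [|p IHp]; last rewrite -[p.+1]/(1 + p)%N; move=> N N0 ND NZ.
  exists 0%N, 0 => u; split=> [_|_]; first by exists 0; rewrite !thinmx0.
  by rewrite thinmx0.
pose I f := exists w : 'rV_p, N (row_mx f%:M w : 'rV_(1 + p)).
have [|f g [w Nw] [w' Nw']|a f [w Nw]|s [g [Ig gI]]] := @ideal_fg I.
- by exists 0; rewrite raddf0 row_mx0.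
- by exists (w + w'); rewrite raddfD -add_row_mx; apply: ND.
- by exists (a *: w); rewrite -scale_scalar_mx -scale_row_mx; apply: NZ.
have /choice[w wP] := Ig; pose W := \matrix_(i < s) w i.
have NW (z : 'rV_s) : N (z *m row_mx g W).
  rewrite mulmx_sum_row; elim/big_ind: _ => // i _; apply: NZ; rewrite row_row_mx.
  rewrite rowK; suff -> : row i g = (g i 0)%:M by [].
  by apply/rowP => j; rewrite !ord1 !mxE.
pose N' (w : 'rV_p) := N (row_mx (0 : 'M_1) w).
have [|u v Nu Nv|a u Nu|s' [G' G'P]] := IHp N'.
- by rewrite /N' row_mx0.
- by rewrite /N' -[0]addr0 -add_row_mx; apply: ND.
- by rewrite /N' -[0](scaler0 _ a) -scale_row_mx; apply: NZ.
exists (s + s')%N, (col_mx (row_mx g W) (row_mx 0 G')) => u; split=> [Nu|[z ->]].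
  have [|z uz] := gI (lsubmx u 0 0).
    by exists (rsubmx u); rewrite -mx11_scalar hsubmxK.
  have [|z' z'P] := proj1 (G'P (rsubmx u - z *m W)).
    rewrite /N'; suff -> : row_mx (0 : 'M_1) (rsubmx u - z *m W) =
        u + (-1) *: (z *m row_mx g W) :> 'rV_(1 + p).
      by apply: ND => //; apply: NZ.
    rewrite scaleN1r mul_mx_row -[u in RHS](@hsubmxK _ _ 1 p) opp_row_mx.
    apply/esym; apply: etrans (add_row_mx _ _ _ _) _.
    by congr row_mx; apply/rowP => j; rewrite !ord1 [LHS]mxE uz [X in _ + X]mxE subrr mxE.
  exists (row_mx z z'); rewrite mul_row_col !mul_mx_row add_row_mx mulmx0 addr0 -z'P.
  rewrite addrC subrK -[LHS](@hsubmxK _ _ 1 p); congr row_mx.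
  by apply/rowP => j; rewrite !ord1 uz.
rewrite -[z]hsubmxK mul_row_col; apply: ND => //.
by rewrite mul_mx_row mulmx0; apply/G'P; exists (rsubmx z).
Qed.

Lemma kernel_fg r p (B : 'M[R]_(r, p)) :
  exists s (C : 'M[R]_(s, r)), forall u : 'rV_r, u *m B = 0 <-> exists z, u = z *m C.
Proof.
apply: (@submodule_fg r (fun u : 'rV_r => u *m B = 0)) => [|u v uB vB|a u uB].
- by rewrite mul0mx.
- by rewrite mulmxDl uB vB addr0.
- by rewrite -scalemxAl uB scaler0.
Qed.

(** Induction on columns, with [B] split into its first column [b] and the rest [B']. After [s0] has
    matched the first coordinate, the remaining freedom is the kernel of [b], generated by [C]; so
    the other coordinates are split by [C *m B']. *)
Lemma split_mx r p (B : 'M[R]_(r, p)) :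
  exists (s : 'rV_p -> 'rV_r) (D : seq F), [/\ const_linear s, preserves_over D s
    & forall u : 'rV_r, s (u *m B) *m B = u *m B].
Proof.
elim: p r B => [|p IHp]; last rewrite -[p.+1]/(1 + p)%N; move=> r B.
  exists (fun=> 0), [::]; split=> [|O _ u _|u]; last by rewrite !thinmx0.
    by split=> [u v|c u]; rewrite ?addr0 ?scaler0.
  exact: over0.
pose b := lsubmx B; pose B' := rsubmx B.
have BE : B = row_mx b B' by rewrite hsubmxK.
have [s0 [D0 [[s0D s0Z] s0O s0P]]] := split_col b.
have [t [C CP]] := kernel_fg b.
have [s1 [D1 [[s1D s1Z] s1O s1P]]] := IHp _ (C *m B').
pose w0 (w : 'rV[R]_(1 + p)) := lsubmx w.
pose w1 (w : 'rV[R]_(1 + p)) := rsubmx w.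
exists (fun w => s0 (w0 w) + s1 (w1 w - s0 (w0 w) *m B') *m C).
exists (D0 ++ D1 ++ mxcoefs B' ++ mxcoefs C); split.
- have w0D u v : w0 (u + v) = w0 u + w0 v by apply/rowP => j; rewrite !mxE.
  have w1D u v : w1 (u + v) = w1 u + w1 v by apply/rowP => j; rewrite !mxE.
  have w0Z a u : w0 (a *: u) = a *: w0 u by apply/rowP => j; rewrite !mxE.
  have w1Z a u : w1 (a *: u) = a *: w1 u by apply/rowP => j; rewrite !mxE.
  split=> [u v|c u].
    rewrite /= w0D w1D s0D mulmxDl opprD [w1 u + _ + _]addrACA.
    by rewrite (s1D (w1 u - s0 (w0 u) *m B')) mulmxDl addrACA.
  by rewrite w0Z w1Z s0Z -scalemxAl -scalerBr s1Z -scalemxAl scalerDr.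
- move=> O DO u uO.
  have oB' : over O B' by apply: (@mxcoefsP _ _ B' _ _ O DO) => x xB; rewrite !mem_cat xB !orbT.
  have oC : over O C by apply: (@mxcoefsP _ _ C _ _ O DO) => x xB; rewrite !mem_cat xB !orbT.
  have oW0 : over O (w0 u) by move=> i j; rewrite mxE.
  have oW1 : over O (w1 u) by move=> i j; rewrite mxE.
  have oS0 : over O (s0 (w0 u)).
    by apply: s0O => // x xD; apply: DO; rewrite mem_cat xD.
  apply: overD => //; apply: overM => //; apply: s1O.
    by move=> x xD; apply: DO; rewrite !mem_cat xD !orbT.
  by apply: overB => //; apply: overM.
move=> u; rewrite /w0 /w1 BE !mul_mx_row row_mxKl row_mxKr.
have [z zP] : exists z, u - s0 (u *m b) = z *m C.
  by apply/CP; rewrite mulmxBl s0P subrr.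
have CB : C *m b = 0.
  apply/row_matrixP => i; rewrite row0 rowE mulmxA.
  by apply/CP; exists (delta_mx 0 i).
rewrite !mulmxDl s0P -mulmxA CB mulmx0 addr0 -[u *m B' - _]mulmxBl zP; congr row_mx.
by rewrite -mulmxA -[z *m C *m B']mulmxA s1P mulmxA -zP mulmxBl addrC subrK.
Qed.

End Groebner.

(** * Hilbert's syzygy theorem *)

Lemma cover_retract (R : comNzRingType) (X : lmodType R) : projective X ->
  exists r : {linear {freeg X / R} -> syz X}, forall w : syz X, r (val w) = w.
Proof.
move=> pX; have [s sP] := pX _ _ (@cover R X) idfun (@cover_surj R X).
have lr : linear (fun D : {freeg X / R} => D - s (cover D)).
  by move=> a D E; rewrite [cover _]linearP [s _]linearP opprD scalerBr addrACA.
have [|r rP] := @to_ker _ _ _ _ (@cover R X) (mklin lr).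
  by move=> D; rewrite /= /mklin /lin_fun linearB /= sP subrr.
exists r => w; apply: val_inj; rewrite rP /= /mklin /lin_fun.
by rewrite [cover _](kermodP w) linear0 subr0.
Qed.

Lemma projective_syz (R : comNzRingType) (X : lmodType R) :
  projective X -> projective (syz X).
Proof.
move=> /cover_retract[r rK] U V f g fs.
have lgr : linear (g \o r) by move=> a D E; rewrite /= !linearP.
have [h hP] := @projective_freeg R X _ _ f (mklin lgr) fs.
have lh : linear (h \o val : syz X -> U) by move=> a D E; rewrite /= !linearP.
by exists (mklin lh) => w; rewrite [LHS]hP -[in RHS](rK w).
Qed.

Lemma ext_eq0_of_projective (R : comNzRingType) (L M : lmodType R) i :
  projective (iter i (@syz R) L) -> forall x : Ext i.+1 L M, x = 0.
Proof.
move=> /cover_retract[r rK] x; have [f [fs fk]] := ext_is_ext1 L M i.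
have [h <-] := fs x; apply/fk.
have lhr : linear (h \o r) by move=> a D E; rewrite /= !linearP.
by exists (mklin lhr) => w; rewrite -[in LHS](rK w).
Qed.

Section ConstExtension.
Variables (n : nat) (K : fieldType).
Local Notation R := {mpoly K[n]}.
Variables (X U : lmodType R).

Section LFreeg.
Variable h : 'X_{1..n} -> X -> U.

(** The elements [<< 'X_[m] *g x >>] are a basis of the free module over the constants; this is the
    constant-linear map with value [h m x] there. *)
Definition lfreeg (D : {freeg X / R}) : U :=
  \sum_(x <- dom D) lext (h^~ x) (coeff x D).

Lemma lext0 v : lext v 0 = 0 :> U.
Proof. by rewrite /lext msupp0 big_nil. Qed.

Lemma lfreegE D s : uniq s -> {subset dom D <= s} ->
  lfreeg D = \sum_(x <- s) lext (h^~ x) (coeff x D).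
Proof.
move=> us Ds; rewrite [RHS](bigID (mem (dom D))) /= [X in _ + X]big1 ?addr0.
  rewrite -big_filter; apply: perm_big; apply: uniq_perm; rewrite ?filter_uniq ?uniq_dom //.
  by move=> x; rewrite mem_filter andb_idr //; apply: Ds.
by move=> x /coeff_outdom ->; rewrite lext0.
Qed.

Lemma lfreegD : {morph lfreeg : D E / D + E}.
Proof.
move=> D E; pose s := undup (dom (D + E) ++ dom D ++ dom E).
have us : uniq s by apply: undup_uniq.
rewrite !(@lfreegE _ s us) => [|x xD|x xD|x xD]; rewrite ?mem_undup ?mem_cat ?xD ?orbT //.
by rewrite -big_split; apply: eq_bigr => x _; rewrite coeffD lextD.
Qed.

Lemma lfreegZ c D : lfreeg (c%:MP *: D) = c%:MP *: lfreeg D.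
Proof.
pose s := undup (dom (c%:MP *: D) ++ dom D).
have us : uniq s by apply: undup_uniq.
rewrite !(@lfreegE _ s us) => [|x xD|x xD]; rewrite ?mem_undup ?mem_cat ?xD ?orbT //.
by rewrite scaler_sumr; apply: eq_bigr => x _; rewrite coeffZ mul_mpolyC lextZ.
Qed.

Lemma lfreegX m x : lfreeg << 'X_[m] *g x >> = h m x.
Proof.
rewrite /lfreeg domU ?big_seq1 ?coeffU ?eqxx ?mulr1 ?lextX //.
by rewrite -mleadc_eq0 mleadXm mcoeffX eqxx oner_eq0.
Qed.

End LFreeg.

Definition const_lin (Y Z : lmodType R) (g : Y -> Z) :=
  {morph g : x y / x + y} /\ forall c x, g (c%:MP *: x) = c%:MP *: g x.

Lemma const_lin0 (Y Z : lmodType R) (g : Y -> Z) : const_lin g -> g 0 = 0.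
Proof. by case=> _ gZ; rewrite -[0 in LHS](scale0r 0) -mpolyC0 gZ mpolyC0 scale0r. Qed.

Lemma const_lin_sum (Y Z : lmodType R) (g : Y -> Z) (I : Type) (r : seq I) F :
  const_lin g -> g (\sum_(i <- r) F i) = \sum_(i <- r) g (F i).
Proof. by move=> gl; apply: big_morph; [case: gl | apply: const_lin0]. Qed.

Lemma freegZE (a : R) (x : X) : << a *g x >> = a *: << x >> :> {freeg X / R}.
Proof. by apply/eqP/freeg_eqP => y; rewrite coeffZ !coeffU mul1r. Qed.

Lemma const_lin_eq (f g : {freeg X / R} -> U) : const_lin f -> const_lin g ->
  (forall m x, f << 'X_[m] *g x >> = g << 'X_[m] *g x >>) -> f =1 g.
Proof.
move=> fl gl fg D; rewrite -[D]freeg_sumE !const_lin_sum //; apply: eq_bigr => x _.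
rewrite [coeff x D]mpolyE freegZE scaler_suml !const_lin_sum //.
apply: eq_bigr => m _; rewrite -mul_mpolyC -scalerA -freegZE.
by rewrite fl.2 gl.2 fg.
Qed.

End ConstExtension.

(** * Projectivity relative to a polynomial subring *)

Section RelativeProjective.
Variables (n : nat) (K : fieldType).
Local Notation R := {mpoly K[n]}.
Implicit Types X Y Z U V W : lmodType R.

(* Linearity over the subring [K[x_0, ..., x_(j-1)]]. *)
Definition lin_upto j Y Z (g : Y -> Z) :=
  const_lin g /\ forall (i : 'I_n) x, (i < j)%N -> g ('X_i *: x) = 'X_i *: g x.

Definition proj_upto j X := forall U V (f : {linear U -> V}) (g : X -> V),
  surj f -> lin_upto j g -> exists h : X -> U, lin_upto j h /\ forall x, f (h x) = g x.

Lemma scaleC Y (a b : R) (v : Y) : a *: (b *: v) = b *: (a *: v).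
Proof. by rewrite !scalerA mulrC. Qed.

Lemma linear_const_lin Y Z (g : {linear Y -> Z}) : const_lin g.
Proof. by split=> [x y|c x]; rewrite ?linearD ?linearZ. Qed.

Lemma linear_lin_upto j Y Z (g : {linear Y -> Z}) : lin_upto j g.
Proof. by split=> [|i x _]; [apply: linear_const_lin | rewrite linearZ]. Qed.

Lemma const_lin_comp X Y Z (f : Y -> Z) (g : X -> Y) :
  const_lin f -> const_lin g -> const_lin (f \o g).
Proof. by move=> [fD fZ] [gD gZ]; split=> [x y|c x] /=; rewrite ?gD ?gZ. Qed.

Lemma lin_upto_comp j X Y Z (f : Y -> Z) (g : X -> Y) :
  lin_upto j f -> lin_upto j g -> lin_upto j (f \o g).
Proof.
move=> [fl fX] [gl gX]; split=> [|i x ij]; first exact: const_lin_comp.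
by rewrite /= gX // fX.
Qed.

Lemma lin_upto_le j j' Y Z (g : Y -> Z) : (j <= j')%N -> lin_upto j' g -> lin_upto j g.
Proof. by move=> jj [gl gX]; split=> // i x ij; apply: gX; apply: leq_trans jj. Qed.

Lemma lin_uptoX j Y Z (g : Y -> Z) (m : 'X_{1..n}) x : lin_upto j g ->
  (forall i : 'I_n, (j <= i)%N -> m i = 0%N) -> g ('X_[m] *: x) = 'X_[m] *: g x.
Proof.
move=> [_ gX] mj; rewrite mpolyXE_id.
elim/big_ind: _ x => [x|a b IHa IHb x|i _ x]; first by rewrite !scale1r.
  by rewrite -!scalerA IHa IHb.
have [ji|ij] := leqP j i; first by rewrite mj // !scale1r.
by elim: (m i) x => [|k IHk] x; rewrite ?scale1r // exprS -!scalerA gX // IHk.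
Qed.

Lemma lin_upto_linear Y Z (g : Y -> Z) : lin_upto n g -> linear g.
Proof.
move=> gl a x y; have [[gD gZ] _] := gl; rewrite gD; congr (_ + _).
rewrite [a]mpolyE !scaler_suml (const_lin_sum _ _ gl.1); apply: eq_bigr => m _.
rewrite -mul_mpolyC -!scalerA gZ (lin_uptoX _ gl) // => i.
by rewrite leqNgt ltn_ord.
Qed.

Lemma proj_upto_projective X : proj_upto n X -> projective X.
Proof.
move=> pX U V f g fs; have [h [hl hP]] := pX U V f g fs (linear_lin_upto _ _).
by exists (mklin (lin_upto_linear hl)).
Qed.

Lemma iteri_kernel_lift U V (f : {linear U -> V}) (y : R) (t : nat -> U) u k :
  f (iteri k (fun l acc => y *: acc + t l) u) =
  iteri k (fun l acc => y *: acc + f (t l)) (f u).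
Proof. by elim: k => //= k IHk; rewrite linearP IHk. Qed.

(* [rho = 1 - s c] is linear only over [K[x_0, ..., x_(j-1)]]: for [y = 'X_j] we
   have [rho (y D) = y (rho D) + delta (c D)].  With a lift [t] of [g delta],
   there is a lift [H] of [g rho] such that [H (y D) = y (H D) + t (c D)], so that
   [H] commutes with [y] on the kernel of [c]. *)
Lemma proj_upto_syz j X : (j < n)%N -> proj_upto j X -> proj_upto j.+1 (syz X).
Proof.
move=> jn pX U V f g fs gl; pose J := Ordinal jn; pose y : R := 'X_J.
have gl' : lin_upto j g := lin_upto_le (leqnSn j) gl.
have gy w : g (y *: w) = y *: g w by apply: gl.2.
pose c : {linear {freeg X / R} -> X} := @cover R X.
have cs : surj c := @cover_surj R X.
have [s [sl sP]] := pX _ _ c idfun cs (linear_lin_upto _ _).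
have r0 D : D - s (c D) \in ker_pred c by apply/eqP; rewrite linearB /= sP subrr.
pose rho D : syz X := KerMod (r0 D).
have d0 x : y *: s x - s (y *: x) \in ker_pred c.
  by apply/eqP; rewrite linearB linearZ /= !sP subrr.
pose delta x : syz X := KerMod (d0 x).
have rhol : lin_upto j rho.
  have [[sD sZ] sX] := sl; split; first split.
  - by move=> D E; apply: val_inj; rewrite /= linearD sD opprD addrACA.
  - by move=> a D; apply: val_inj; rewrite /= linearZ sZ scalerBr.
  - by move=> i D ij; apply: val_inj; rewrite /= linearZ sX // scalerBr.
have deltal : lin_upto j delta.
  have [[sD sZ] sX] := sl; split; first split.
  - move=> x x'; apply: val_inj; rewrite /= scalerDr !sD scalerDr opprD.
    by rewrite addrACA.
  - move=> a x; apply: val_inj.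
    by rewrite /delta /= scaleC !sZ scaleC scalerBr.
  - move=> i x ij; apply: val_inj.
    by rewrite /delta /= scaleC (sX i x) // (sX i (y *: x)) // scaleC scalerBr.
have rhoy D : rho (y *: D) = y *: rho D + delta (c D).
  by apply: val_inj; rewrite /= linearZ /= scalerBr addrA subrK.
have [t [tl tP]] := pX _ _ f (g \o delta) fs (lin_upto_comp gl' deltal).
have /choice[u uP] : forall mx : 'X_{1..n} * X, exists u,
    f u = g (rho << 'X_[mx.1] *g mx.2 >>) by move=> mx; apply: fs.
pose lo (m : 'X_{1..n}) := [multinom if (i < j)%N then m i else 0%N | i < n].
pose hi (m : 'X_{1..n}) := [multinom if (j < i)%N then m i else 0%N | i < n].
have mE m : m = (lo m + (U_(J) *+ m J + hi m))%MM.
  apply/mnmP => i; rewrite !mnmDE mulmnE mnm1E !mnmE.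
  have [->|nJ] := eqVneq i J; first by rewrite ltnn mul1n addn0.
  case: ltngtP => [||ij]; rewrite ?addn0 //.
  by case/eqP: nJ; apply: val_inj.
(* Solves the rule for [H (y D)] by recursion on the exponent of [y], starting from arbitrary lifts
   [u] at monomials in the variables after [x_j]. Variables before [x_j] are factored out, as all
   maps involved are linear in them. *)
pose h m x := 'X_[lo m] *:
  iteri (m J) (fun k acc => y *: acc + t (y ^+ k *: ('X_[hi m] *: x))) (u (hi m, x)).
have loX m (i : 'I_n) : (j <= i)%N -> lo m i = 0%N by move=> ji; rewrite mnmE ltnNge ji.
have fh m x : f (h m x) = g (rho << 'X_[m] *g x >>).
  rewrite linearZ /= iteri_kernel_lift uP.
  have -> : iteri (m J) (fun k acc => y *: acc + f (t (y ^+ k *: ('X_[hi m] *: x))))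
      (g (rho << 'X_[hi m] *g x >>)) =
      g (rho (y ^+ m J *: << 'X_[hi m] *g x >>)).
    elim: (m J) => [|k IHk] /=; first by rewrite expr0 scale1r.
    rewrite IHk tP exprS -scalerA rhoy gl.1.1 gy; congr (_ + g (delta _)).
    by rewrite [RHS]linearZ; congr (_ *: _); apply: esym; apply: liftU.
  set E := y ^+ m J *: _; transitivity (g ('X_[lo m] *: rho E)).
    by rewrite (lin_uptoX _ gl' (@loX m)).
  transitivity (g (rho ('X_[lo m] *: E))); first by rewrite (lin_uptoX _ rhol (@loX m)).
  congr (g (rho _)); rewrite [in RHS](mE m) !mpolyXD -mpolyXn /E.
  by rewrite [RHS]freegZE -!scalerA -freegZE.
pose H := lfreeg h.
have Hl : const_lin H by split; [apply: lfreegD | apply: lfreegZ].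
have HX m x : H << 'X_[m] *g x >> = h m x by apply: lfreegX.
have XX (i : 'I_n) m x : 'X_i *: << 'X_[m] *g x >> =
    << 'X_[(U_(i) + m)%MM] *g x >> :> {freeg X / R}.
  by rewrite mpolyXD freegZE scalerA -freegZE.
have scale_lin (Y : lmodType R) (a : R) : const_lin ( *:%R a : Y -> Y).
  by split=> [v w|b v]; rewrite ?scalerDr // scaleC.
have Hi (i : 'I_n) D : (i < j)%N -> H ('X_i *: D) = 'X_i *: H D.
  move=> ij; apply: (const_lin_eq (const_lin_comp Hl (scale_lin _ _))
    (const_lin_comp (scale_lin _ _) Hl)) => m x /=.
  rewrite XX !HX /h scalerA -mpolyXD.
  have -> : lo (U_(i) + m)%MM = (U_(i) + lo m)%MM.
    apply/mnmP => l; rewrite !(mnmDE, mnmE).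
    by have [<-|il] := eqVneq i l; rewrite ?ij //; case: ifP.
  have -> : hi (U_(i) + m)%MM = hi m.
    apply/mnmP => l; rewrite !(mnmDE, mnmE).
    by have [<-|il] := eqVneq i l; rewrite // ltnNge ltnW.
  rewrite mnmDE mnm1E; have -> : (i == J) = false by rewrite -val_eqE /= ltn_eqF.
  by [].
have Hy D : H (y *: D) = y *: H D + t (c D).
  have tcl : const_lin (t \o c) := const_lin_comp tl.1 (linear_const_lin c).
  have yHl : const_lin (fun D => y *: H D + t (c D)).
    have [[HD HZ] [tD tZ]] := (Hl, tcl); split=> [D' E|a D'].
      by rewrite HD scalerDr [t (c _)]tD addrACA.
    by rewrite HZ [t (c _)]tZ scalerDr !scalerA mulrC.
  apply: (const_lin_eq (const_lin_comp Hl (scale_lin _ _)) yHl) => m x /=.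
  rewrite XX !HX /h.
  have -> : lo (U_(J) + m)%MM = lo m.
    apply/mnmP => l; rewrite !(mnmDE, mnmE).
    by have [<-|il] := eqVneq J l; rewrite //= ltnn.
  have -> : hi (U_(J) + m)%MM = hi m.
    apply/mnmP => l; rewrite !(mnmDE, mnmE).
    by have [<-|il] := eqVneq J l; rewrite //= ltnn.
  rewrite mnmDE mnm1E eqxx add1n /= scalerDr !scalerA mulrC; congr (_ + _).
  rewrite -(lin_uptoX _ tl (@loX m)).
  congr (t _); rewrite [c _]liftU !scalerA [in RHS](mE m) !mpolyXD -mpolyXn.
  by rewrite mulrA.
exists (H \o val); split=> [|w]; last first.
  (* [rho] is the identity on the kernel of [c], so there [H] lifts [g] itself. *)
  have fHE D : f (H D) = g (rho D).
    apply: (const_lin_eq (const_lin_comp (linear_const_lin f) Hl)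
      (const_lin_comp gl.1 rhol.1)) => m x.
    by rewrite /= HX fh.
  rewrite /= fHE; congr (g _); apply: val_inj.
  by rewrite /= [c _](kermodP w) (const_lin0 sl.1) subr0.
split=> [|i w]; first exact: const_lin_comp Hl (linear_const_lin _).
rewrite ltnS leq_eqVlt => /orP[/eqP ij|ij]; last exact: Hi.
have -> : i = J by apply: val_inj.
rewrite /= [LHS]Hy [c _](kermodP w) (const_lin0 tl.1) addr0; exact: erefl.
Qed.

(** Base case, relative to the field [K]. [pr] is a [K]-linear projection onto the image of [D0], so
    [v - pr v] depends only on [c v] and yields a [K]-linear section of [c]; [h0] is a [K]-linear
    lift of [g] after [c]. *)
Lemma proj_upto0 (L : lmodType R) p0 p1 (D0 : 'M[R]_(p0, p1))
    (c : {linear 'cV[R]_p0 -> L}) :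
  surj c -> (forall x, c x = 0 <-> exists z, x = D0 *m z) -> proj_upto 0 L.
Proof.
move=> cs ck U V f g fs [gl _].
have [s [_ [[sD sZ] _ sP]]] := split_mx D0^T.
pose pr (v : 'cV_p0) := D0 *m (s v^T)^T.
have prl : const_lin pr.
  split=> [v w|a v]; rewrite /pr; first by rewrite linearD sD linearD mulmxDr.
  by rewrite linearZ sZ linearZ scalemxAr.
have prK z : pr (D0 *m z) = D0 *m z.
  by apply: trmx_inj; rewrite /pr !trmx_mul !trmxK sP.
have cpr v : c (pr v) = 0 by apply/ck; exists (s v^T)^T.
have /choice[u uP] : forall mi : 'X_{1..n} * 'I_p0, exists u,
    f u = g (c ('X_[mi.1] *: delta_mx mi.2 0)) by move=> mi; apply: fs.
pose h0 (v : 'cV[R]_p0) := \sum_i lext (fun m => u (m, i)) (v i 0).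
have h0l : const_lin h0.
  split=> [v w|a v]; rewrite /h0.
    by rewrite -big_split; apply: eq_bigr => i _; rewrite mxE lextD.
  by rewrite scaler_sumr; apply: eq_bigr => i _; rewrite mxE mul_mpolyC lextZ.
have fh0 v : f (h0 v) = g (c v).
  have gcl : const_lin (g \o c) := const_lin_comp gl (linear_const_lin c).
  rewrite [in RHS](matrix_sum_delta v) -[g _]/((g \o c) _) (const_lin_sum _ _ gcl).
  rewrite raddf_sum; apply: eq_bigr => i _; rewrite big_ord1.
  rewrite [v i 0 in RHS]mpolyE scaler_suml (const_lin_sum _ _ gcl) raddf_sum.
  apply: eq_bigr => m _; rewrite -mul_mpolyC -scalerA gcl.2 /= -(uP (m, i)) /=.
  by rewrite linearZ.
have /choice[r rP] := cs.
have ql : const_lin (fun v => h0 (v - pr v)).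
  have [[pD pZ] [hD hZ]] := (prl, h0l).
  split=> [v w|a v]; last by rewrite pZ -scalerBr hZ.
  by rewrite -hD pD opprD; congr h0; apply: addrACA.
have hE v w : c v = c w -> h0 (v - pr v) = h0 (w - pr w).
  move=> /eqP; rewrite -subr_eq0 -linearB => /eqP/ck[z zP].
  have -> : v = D0 *m z + w by rewrite -zP subrK.
  by apply: etrans (ql.1 _ _) _; rewrite prK subrr (const_lin0 h0l) add0r.
have hl : const_lin (fun l => h0 (r l - pr (r l))).
  split=> [x y|a x].
    by rewrite -ql.1; apply: hE; rewrite linearD !rP.
  by rewrite -ql.2; apply: hE; rewrite linearZ /= !rP.
exists (fun l => h0 (r l - pr (r l))); split=> [|l]; first by split.
by rewrite fh0 linearB /= cpr subr0 rP.
Qed.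

Theorem ext_vanish (L M : lmodType R) p0 p1 (D0 : 'M[R]_(p0, p1))
    (c : {linear 'cV[R]_p0 -> L}) i :
  surj c -> (forall x, c x = 0 <-> exists z, x = D0 *m z) -> (n < i)%N ->
  forall x : Ext i L M, x = 0.
Proof.
move=> cs ck; case: i => // i; rewrite ltnS => ni; apply: ext_eq0_of_projective.
(* Each syzygy gains one variable, so the [n]-th is projective; later ones remain so, being retracts
   of free modules. *)
have pj j : (j <= n)%N -> proj_upto j (iter j (@syz R) L).
  elim: j => [_|j IHj jn]; first exact: proj_upto0 cs ck.
  by apply: proj_upto_syz => //; apply: IHj; apply: ltnW.
rewrite -(subnK ni); elim: (i - n)%N => [|d IHd]; last exact: projective_syz.
by apply/proj_upto_projective/pj.
Qed.

End RelativeProjective.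

(** * Specialization of polynomials *)

Lemma fraction_num_den (T : idomainType) (x : {fraction T}) :
  exists p q : T, q != 0 /\ x = (tofrac q)^-1 * tofrac p.
Proof.
elim/quotW: x => r; exists (\n_r), (\d_r); split; first exact: denom_ratioP.
have d0 : tofrac \d_r != 0 by rewrite tofrac_eq0 denom_ratioP.
suff e : \pi_({fraction T}) r * tofrac \d_r = tofrac \n_r.
  by rewrite -e [X in _ * X]mulrC mulrA mulVf // mul1r.
unlock FracField.tofrac; rewrite -[LHS]FracField.pi_mul; apply/eqP.
rewrite FracField.equivf_def /FracField.mulf.
by rewrite !numden_Ratio ?mulf_neq0 ?oner_neq0 ?denom_ratioP // !mulr1 mulrC.
Qed.

Lemma digits_inj n N (f g : 'I_n -> nat) :
  (forall i, (f i < N)%N) -> (forall i, (g i < N)%N) ->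
  (\sum_(i < n) f i * N ^ i = \sum_(i < n) g i * N ^ i)%N -> f =1 g.
Proof.
elim: n f g => [|n IHn] f g fN gN; first by move=> _ [].
rewrite !big_ord_recl /= !expn0 !muln1.
have shift (h : 'I_n.+1 -> nat) : (\sum_(i < n) h (fintype.lift ord0 i) * N ^ bump 0 i =
    (\sum_(i < n) h (fintype.lift ord0 i) * N ^ i) * N)%N.
  by rewrite big_distrl; apply: eq_bigr => i _; rewrite /bump expnSr mulnA.
rewrite !shift => e.
have N0 : (0 < N)%N by apply: leq_ltn_trans (fN ord0).
have e0 : f ord0 = g ord0.
  by have := congr1 (modn^~ N) e; rewrite !(addnC (_ ord0)) !modnMDl !modn_small.
move/eqP: e; rewrite e0 eqn_add2l eqn_pmul2r // => /eqP e i.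
case: (unliftP ord0 i) => [j ->|->//].
by apply: (IHn (f \o fintype.lift ord0) (g \o fintype.lift ord0)) => //=.
Qed.

Lemma infinite_poly_nonroot (k : fieldType) (p : {poly k}) :
  infinite_set [set: k]%classic -> p != 0 -> exists t, p.[t] != 0.
Proof.
move=> kinf p0; apply: contrapT => nr.
have r t : root p t.
  by apply/negPn/negP => nt; apply: nr; exists t.
have us N : exists s : seq k, uniq s /\ size s = N.
  elim: N => [|N [s [us <-]]]; first by exists [::].
  have [[x xs]|ns] := pselect (exists x, x \notin s).
    by exists (x :: s); rewrite /= xs.
  case: kinf; apply/finite_seqP; exists s; apply/seteqP; split=> // x _ /=.
  by apply/negPn/negP => nx; apply: ns; exists x.
have [s [us_ ss]] := us (size p).
have rs : all (root p) s by apply/allP => x _.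
by have := max_poly_roots p0 rs us_; rewrite ss ltnn.
Qed.

(* Kronecker substitution [x_i := t ^ (N ^ i)]. *)
Lemma infinite_mpoly_nonroot (k : fieldType) m (p : {mpoly k[m]}) :
  infinite_set [set: k]%classic -> p != 0 -> exists a, p.@[a] != 0.
Proof.
(* [N] exceeds every exponent in [p], so distinct monomials get distinct base-[N] numbers [e d] and
   nothing cancels in [q]. *)
move=> kinf p0; pose N := msize p.
pose e (d : 'X_{1..m}) := (\sum_(i < m) d i * N ^ i)%N.
pose q : {poly k} := \sum_(d <- msupp p) p@_d *: 'X^(e d).
have dN d : d \in msupp p -> forall i, (d i < N)%N.
  move=> dp i; apply: leq_ltn_trans (msize_mdeg_lt dp).
  by rewrite mdegE (bigD1 i) //= leq_addr.
have q0 : q != 0.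
  have lp := mlead_supp p0.
  apply: contra_neq p0 => q0; apply/eqP; rewrite -mleadc_eq0.
  have := congr1 (fun r : {poly k} => r`_(e (mlead p))) q0.
  rewrite coef0 /q coef_sum (bigD1_seq (mlead p)) ?msupp_uniq //= big_seq_cond.
  rewrite big1 ?addr0 => [|d /andP[dp dl]]; first by rewrite coefZ coefXn eqxx mulr1 => ->.
  rewrite coefZ coefXn; case: eqP => [ed|]; last by rewrite mulr0.
  by case/eqP: dl; apply/mnmP/(digits_inj _ _ (esym ed)); apply: dN.
have [t tP] := infinite_poly_nonroot kinf q0.
exists (fun i => t ^+ (N ^ i)); suff -> : p.@[fun i => t ^+ (N ^ i)] = q.[t] by [].
rewrite mevalE horner_sum; apply: eq_bigr => d _; rewrite hornerZ hornerXn.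
congr (_ * _); rewrite /e -prodrXr; apply: eq_bigr => i _.
by rewrite -exprM mulnC.
Qed.

Lemma invf_subr (E : fieldType) (p q r s : E) : q != 0 -> s != 0 ->
  q^-1 * p - s^-1 * r = (q * s)^-1 * (s * p - q * r).
Proof. by move=> q0 s0; field; rewrite q0 s0. Qed.

Section MapFraction.
Variables (n : nat) (T : comNzRingType) (E : fieldType) (f : {rmorphism T -> E}).
Implicit Types p r : {mpoly T[n]}.

(** With [f] the embedding into k(u) this is the element of R represented by [p] and [q]; with [f]
    the evaluation it is its specialization. Identities are proved once for both. *)
Definition mfrac p q : {mpoly E[n]} := (f q)^-1 *: map_mpoly f p.

Lemma mcoeff_mfrac p q i : (mfrac p q)@_i = (f q)^-1 * f p@_i.
Proof. by rewrite mcoeffZ mcoeff_map_mpoly. Qed.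

Lemma mfracB p r q s : f q != 0 -> f s != 0 ->
  mfrac p q - mfrac r s = mfrac (s *: p - q *: r) (q * s).
Proof.
move=> q0 s0; apply/mpolyP => i; rewrite mcoeffB !mcoeff_mfrac mcoeffB !mcoeffZ.
by rewrite rmorphB !rmorphM invf_subr.
Qed.

Lemma mfracM p r q s : mfrac p q * mfrac r s = mfrac (p * r) (q * s).
Proof. by rewrite /mfrac !rmorphM /= -scalerAl -scalerAr scalerA invfM. Qed.

Lemma mfrac1 : mfrac 1 1 = 1.
Proof. by rewrite /mfrac !rmorph1 invr1 scale1r. Qed.

Lemma mfracX i : mfrac 'X_[i] 1 = 'X_[i].
Proof. by rewrite /mfrac rmorph1 invr1 scale1r map_mpolyX. Qed.

Lemma mfracC c q : mfrac c%:MP q = ((f q)^-1 * f c)%:MP.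
Proof. by rewrite /mfrac map_mpolyC -mul_mpolyC mpolyCM. Qed.

Lemma mfracCX c i q : mfrac (c *: 'X_[i]) q = ((f q)^-1 * f c) *: 'X_[i].
Proof. by rewrite /mfrac map_mpolyZ map_mpolyX scalerA. Qed.

End MapFraction.

(** * The local ring of a point and specialization as a ring morphism *)

Section Localization.
Variables (k : fieldType) (m n : nat) (K : fieldType).
Variables (iota : {rmorphism k -> K}) (alpha : 'I_m -> K).

Local Notation F := {fraction {mpoly k[m]}}.
Local Notation R := {mpoly F[n]}.
Local Notation evA := (ev iota alpha).
Local Notation A := (adjoin iota alpha).
Local Notation tf := (@tofrac {mpoly k[m]}).
Local Notation has_spec := (@has_spec_at k m n K iota alpha).
Local Notation sp := (@spec k m n K iota alpha).

Lemma evA_neq0 p : evA p != 0 -> tf p != 0.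
Proof. by apply: contraNneq => /eqP; rewrite tofrac_eq0 => /eqP->; rewrite raddf0. Qed.

(** The localization of k[u] at the kernel of evaluation at [alpha], inside k(u). *)
Definition regular : {pred F} := fun a =>
  `[< exists p q, evA q != 0 /\ a = (tf q)^-1 * tf p >].

Lemma regular_subring : subring_closed regular.
Proof.
split=> [|_ _ /asboolP[p [q [q0 ->]]] /asboolP[r [s [s0 ->]]]
         |_ _ /asboolP[p [q [q0 ->]]] /asboolP[r [s [s0 ->]]]]; apply/asboolP.
- by exists 1, 1; rewrite rmorph1 oner_eq0 rmorph1 invr1 mulr1.
- exists (s * p - q * r), (q * s); rewrite rmorphM mulf_neq0 //; split=> //.
  by rewrite tofracM tofracB !tofracM invf_subr ?evA_neq0.
- exists (p * r), (q * s); rewrite rmorphM mulf_neq0 //; split=> //.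
  by rewrite !tofracM invfM mulrACA.
Qed.

HB.instance Definition _ := GRing.isSubringClosed.Build F regular regular_subring.

Definition spec_dom : {pred R} := fun a => `[< exists pq, has_spec a pq >].

Lemma has_specE a p q : has_spec a (p, q) <-> evA q != 0 /\ a = mfrac tf p q.
Proof. by []. Qed.

Lemma spec_mfrac a p q : has_spec a (p, q) -> sp a = mfrac evA p q.
Proof. exact: specE. Qed.

Lemma has_specB a b p q r s : has_spec a (p, q) -> has_spec b (r, s) ->
  has_spec (a - b) (s *: p - q *: r, q * s).
Proof.
move=> /has_specE[q0 ->] /has_specE[s0 ->]; apply/has_specE; split.
  by rewrite rmorphM mulf_neq0.
by rewrite mfracB ?evA_neq0.
Qed.

Lemma has_specM a b p q r s : has_spec a (p, q) -> has_spec b (r, s) ->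
  has_spec (a * b) (p * r, q * s).
Proof.
move=> /has_specE[q0 ->] /has_specE[s0 ->]; apply/has_specE; split.
  by rewrite rmorphM mulf_neq0.
exact: mfracM.
Qed.

Lemma has_spec1 : has_spec 1 (1, 1).
Proof. by apply/has_specE; rewrite rmorph1 oner_eq0 mfrac1. Qed.

Lemma has_specX i : has_spec 'X_[i] ('X_[i], 1).
Proof. by apply/has_specE; rewrite rmorph1 oner_eq0 mfracX. Qed.

Lemma has_specC p q : evA q != 0 -> has_spec ((tf q)^-1 * tf p)%:MP (p%:MP, q).
Proof. by move=> q0; apply/has_specE; rewrite mfracC. Qed.

Lemma spec_dom_subring : subring_closed spec_dom.
Proof.
split=> [|a b /asboolP[[p q] ap] /asboolP[[r s] bp]
         |a b /asboolP[[p q] ap] /asboolP[[r s] bp]]; apply/asboolP.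
- by exists (1, 1); apply: has_spec1.
- by eexists; apply: has_specB ap bp.
- by eexists; apply: has_specM ap bp.
Qed.

HB.instance Definition _ := GRing.isSubringClosed.Build R spec_dom spec_dom_subring.

(** [spec] takes dummy values on the rest of R. On this subring, made a type of its own, it is a
    ring morphism and can be used with [map_mx]. *)
Record loc := Loc { loc_val : R; _ : loc_val \in spec_dom }.

HB.instance Definition _ := [isSub for loc_val].
HB.instance Definition _ := [Choice of loc by <:].
HB.instance Definition _ := [SubChoice_isSubComNzRing of loc by <:].

Definition loc_spec (a : loc) : {mpoly A[n]} := sp (val a).

Lemma loc_specP (a : loc) : exists p q, has_spec (val a) (p, q).
Proof. by case: a => a /= /asboolP[[p q] apq]; exists p, q. Qed.

Lemma loc_spec_zmod : zmod_morphism loc_spec.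
Proof.
move=> a b; have [p [q ap]] := loc_specP a; have [r [s bp]] := loc_specP b.
rewrite /loc_spec raddfB (spec_mfrac ap) (spec_mfrac bp).
have [/has_specE[q0 _] /has_specE[s0 _]] := (ap, bp).
rewrite (mfracB _ _ q0 s0); exact: spec_mfrac (has_specB ap bp).
Qed.

Lemma loc_spec_monoid : monoid_morphism loc_spec.
Proof.
split=> [|a b].
  by rewrite /loc_spec rmorph1 (spec_mfrac has_spec1) mfrac1.
have [p [q ap]] := loc_specP a; have [r [s bp]] := loc_specP b.
rewrite /loc_spec rmorphM (spec_mfrac ap) (spec_mfrac bp) mfracM.
exact: spec_mfrac (has_specM ap bp).
Qed.

HB.instance Definition _ :=
  GRing.isZmodMorphism.Build loc {mpoly A[n]} loc_spec loc_spec_zmod.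
HB.instance Definition _ :=
  GRing.isMonoidMorphism.Build loc {mpoly A[n]} loc_spec loc_spec_monoid.

Lemma spec_domC c : c \in regular -> c%:MP \in spec_dom.
Proof.
move=> /asboolP[p [q [q0 ->]]]; apply/asboolP; exists (p%:MP, q).
exact: has_specC.
Qed.

Lemma spec_domX i : 'X_[i] \in spec_dom.
Proof. by apply/asboolP; exists ('X_[i], 1); apply: has_specX. Qed.

Lemma spec_domE a : (a \in spec_dom) = (a \in mpolyOver n regular).
Proof.
apply/idP/mpolyOverP => [/asboolP[[p q] /has_specE[q0 ->]] i|aO].
  by apply/asboolP; exists p@_i, q; split=> //; apply: mcoeff_mfrac.
rewrite [a]mpolyE rpred_sum // => i _.
rewrite -mul_mpolyC; apply: rpredM; last exact: spec_domX.
exact: spec_domC (aO i).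
Qed.

Lemma spec_coef0 a i : a \in spec_dom -> sp a = 0 -> sp (a@_i)%:MP = 0.
Proof.
move=> /asboolP[[p q] apq]; have [q0 aE] := proj1 (has_specE _ _ _) apq.
rewrite (spec_mfrac apq) => /(congr1 (mcoeff i)).
rewrite mcoeff0 mcoeff_mfrac => p0.
rewrite aE mcoeff_mfrac (spec_mfrac (has_specC _ q0)) mfracC.
by rewrite [X in X%:MP]p0 mpolyC0.
Qed.

Lemma loc_spec_surj : surj loc_spec.
Proof.
have CX (c : A) i : exists a : loc, loc_spec a = c *: 'X_[i].
  case: c => c cA; have /asboolP[p [q [q0 cE]]] := cA.
  have eq0 : evA q != 0 by apply: contraNneq q0 => /(congr1 val) /= ->.
  have h : has_spec (mfrac tf (p *: 'X_[i]) q) (p *: 'X_[i], q) by split.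
  have hd : mfrac tf (p *: 'X_[i]) q \in spec_dom by apply/asboolP; exists (p *: 'X_[i], q).
  exists (Loc hd); rewrite /loc_spec (spec_mfrac h) mfracCX.
  congr (_ *: _); apply: val_inj; rewrite /= cE.
  by rewrite mulrC.
move=> v; rewrite [v]mpolyE; elim: (msupp v) => [|i s [a aP]].
  by exists 0; rewrite big_nil raddf0.
have [b bP] := CX v@_i i; exists (b + a).
by rewrite big_cons raddfD /= aP bP.
Qed.

End Localization.

(** * Specialization of exact sequences *)

Section SpecializeMatrices.
Variables (k : fieldType) (m n : nat) (K : fieldType).
Variables (iota : {rmorphism k -> K}) (alpha : 'I_m -> K).

Local Notation F := {fraction {mpoly k[m]}}.
Local Notation R := {mpoly F[n]}.
Local Notation A := (adjoin iota alpha).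
Local Notation S := (loc n iota alpha).
Local Notation reg := (regular iota alpha).
Local Notation lspec := (@loc_spec k m n K iota alpha).
Local Notation sdom := (@spec_dom k m n K iota alpha).

Definition mxspec p q (B : 'M[R]_(p, q)) : 'M[{mpoly A[n]}]_(p, q) :=
  map_mx (@spec k m n K iota alpha) B.

Definition mxdef p q (B : 'M[R]_(p, q)) :=
  forall i j, B i j \in sdom.

Definition loc_inj : S -> R := val.
HB.instance Definition _ := GRing.RMorphism.on loc_inj.

Lemma loc_mx_inj p q : injective (map_mx loc_inj : 'M_(p, q) -> 'M_(p, q)).
Proof.
move=> B C BC; apply/matrixP => i j; apply: val_inj.
by have := congr1 (fun X : 'M_(p, q) => X i j) BC; rewrite !mxE.
Qed.

Lemma lift_mx p q (B : 'M[R]_(p, q)) : mxdef B -> exists C, map_mx loc_inj C = B.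
Proof.
move=> Bd; exists (\matrix_(i, j) Loc (Bd i j)).
by apply/matrixP => i j; rewrite !mxE.
Qed.

Lemma mxspec_loc p q (C : 'M[S]_(p, q)) : mxspec (map_mx loc_inj C) = map_mx lspec C.
Proof. by apply/matrixP => i j; rewrite !mxE. Qed.

Lemma mxdef_loc p q (C : 'M[S]_(p, q)) : mxdef (map_mx loc_inj C).
Proof. by move=> i j; rewrite mxE; case: (C i j). Qed.

Lemma mxdef_over p q (B : 'M[R]_(p, q)) : over reg B <-> mxdef B.
Proof. by split=> h i j; have := h i j; rewrite spec_domE. Qed.

Lemma mxspecM p q r (B : 'M[R]_(p, q)) (C : 'M[R]_(q, r)) :
  mxdef B -> mxdef C -> mxspec (B *m C) = mxspec B *m mxspec C.
Proof.
move=> /lift_mx[B' <-] /lift_mx[C' <-].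
by rewrite -map_mxM !mxspec_loc map_mxM.
Qed.

Lemma mxspecD p q (B C : 'M[R]_(p, q)) :
  mxdef B -> mxdef C -> mxspec (B + C) = mxspec B + mxspec C.
Proof.
move=> /lift_mx[B' <-] /lift_mx[C' <-].
by rewrite -map_mxD !mxspec_loc map_mxD.
Qed.

Lemma mxspec1 p : mxspec (1%:M : 'M_p) = 1%:M.
Proof. by rewrite -(map_mx1 loc_inj) mxspec_loc map_mx1. Qed.

Lemma mxspec0 p q : mxspec (0 : 'M_(p, q)) = 0.
Proof. by rewrite -(map_mx0 loc_inj) mxspec_loc map_mx0. Qed.

Lemma const_linear0 p q (s : 'rV[R]_p -> 'rV[R]_q) : const_linear s -> s 0 = 0.
Proof. by case=> sD _; apply: (addrI (s 0)); rewrite -sD !addr0. Qed.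

Lemma const_linear_monomials p q (s : 'rV[R]_p -> 'rV[R]_q) u : const_linear s ->
  s u = \sum_i \sum_(d <- msupp (u 0 i))
    ((u 0 i)@_d)%:MP *: s ('X_[d] *: delta_mx 0 i).
Proof.
move=> sl; rewrite {1}[u]row_sum_delta.
rewrite (big_morph s sl.1 (const_linear0 sl)); apply: eq_bigr => i _.
rewrite {1}[u 0 i]mpolyE scaler_suml (big_morph s sl.1 (const_linear0 sl)).
by apply: eq_bigr => d _; rewrite -sl.2 -mul_mpolyC scalerA.
Qed.

(** Expand [x] into monomials: its coefficients specialize to 0, and [s] has specializable values on
    monomials. Thus [s] behaves as if it descended to k(alpha)[x]. *)
Lemma const_linear_null D p q (s : 'rV[R]_p -> 'rV[R]_q) (x : 'rV[S]_p) (y : 'rV[S]_q) :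
  const_linear s -> preserves_over D s -> {subset D <= reg} ->
  map_mx lspec x = 0 -> map_mx loc_inj y = s (map_mx loc_inj x) -> map_mx lspec y = 0.
Proof.
move=> sl sO DO x0 yE; set X := map_mx loc_inj x in yE.
have /choice[t tP] : forall di : 'X_{1..n} * 'I_p, exists t : 'rV[S]_q,
    map_mx loc_inj t = s ('X_[di.1] *: delta_mx 0 di.2).
  move=> di; apply/lift_mx/mxdef_over/(sO _ DO) => i j; rewrite !mxE.
  apply: rpredM; first exact: mpolyOverX.
  by case: (_ && _); [apply: rpred1 | apply: rpred0].
have /choice[c cP] : forall id : 'I_p * 'X_{1..n}, exists c : S,
    loc_inj c = ((X 0 id.1)@_id.2)%:MP /\ lspec c = 0.
  move=> [i d] /=.
  have Xd : X 0 i \in sdom by apply: mxdef_loc.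
  have cd : ((X 0 i)@_d)%:MP \in sdom.
    apply: spec_domC; move: Xd; rewrite spec_domE => /mpolyOverP; exact.
  exists (Loc cd); split=> //; apply: spec_coef0 => //.
  by have := congr1 (fun Z : 'rV_p => Z 0 i) x0; rewrite !mxE.
have -> : y = \sum_i \sum_(d <- msupp (X 0 i)) c (i, d) *: t (d, i).
  apply: loc_mx_inj; rewrite yE (const_linear_monomials _ sl) raddf_sum.
  apply: eq_bigr => i _; rewrite raddf_sum; apply: eq_bigr => d _ /=.
  rewrite map_mxZ tP; congr (_ *: _); have [cE _] := cP (i, d); exact: esym cE.
rewrite -[LHS]/(map_mx (lspec : {rmorphism S -> {mpoly A[n]}}) _).
rewrite raddf_sum big1 // => i _; rewrite raddf_sum big1 // => d _ /=.
rewrite map_mxZ; have [_ c0] := cP (i, d).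
by apply: etrans (congr1 ( *:%R^~ _) c0) (scale0r _).
Qed.

(** Lift [u] to [W] and write [W = s (W *m B) + (W - s (W *m B))]. The second term lies in the
    kernel of [B], hence equals its image under [t] times [C]. If the specialized [B] kills [u],
    then [W *m B] specializes to 0, and so does the first term. *)
Lemma exact_specialize r p q (B : 'M[R]_(r, p)) (C : 'M[R]_(q, r))
    (s : 'rV_p -> 'rV_r) (t : 'rV_r -> 'rV_q) (Ds Dt : seq F) :
  (forall u : 'rV_r, u *m B = 0 <-> exists z, u = z *m C) ->
  const_linear s -> preserves_over Ds s -> (forall u, s (u *m B) *m B = u *m B) ->
  const_linear t -> preserves_over Dt t -> (forall u, t (u *m C) *m C = u *m C) ->
  {subset Ds <= reg} -> {subset Dt <= reg} -> mxdef B -> mxdef C ->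
  forall u : 'rV_r, u *m mxspec B = 0 <-> exists z, u = z *m mxspec C.
Proof.
move=> BC sl sO sP tl tO tP DsO DtO Bd Cd u; split=> [uB|[z ->]]; last first.
  have CB : C *m B = 0.
    apply/row_matrixP => i; rewrite row0 rowE mulmxA.
    by apply/BC; exists (delta_mx 0 i).
  by rewrite -mulmxA -mxspecM // CB mxspec0 mulmx0.
have [B' BE] := lift_mx Bd; have [C' CE] := lift_mx Cd.
have /choice[l lP] := @loc_spec_surj k m n K iota alpha.
pose w : 'rV[S]_r := map_mx l u.
have wu : map_mx lspec w = u by apply/matrixP => i j; rewrite !mxE lP.
pose W := map_mx loc_inj w.
have Wd : over reg W by apply/mxdef_over/mxdef_loc.
have sd : over reg (s (W *m B)).
  by apply: sO => //; apply: overM => //; apply/mxdef_over.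
have [y yE] : exists y : 'rV_r, map_mx loc_inj y = s (W *m B).
  by apply/lift_mx/mxdef_over.
have [z zE] : exists z : 'rV_q, map_mx loc_inj z = t (W - s (W *m B)).
  by apply/lift_mx/mxdef_over/tO => //; apply: overB.
have wE : w = y + z *m C'.
  apply: loc_mx_inj; rewrite map_mxD map_mxM yE zE CE.
  have [v vE] : exists v, W - s (W *m B) = v *m C.
    by apply/BC; rewrite mulmxBl sP subrr.
  by rewrite vE tP -vE addrC subrK.
have y0 : map_mx lspec y = 0.
  apply: (const_linear_null (x := w *m B') sl sO DsO).
    by rewrite map_mxM wu -mxspec_loc BE.
  by rewrite yE map_mxM BE.
exists (map_mx lspec z).
by rewrite -wu wE map_mxD y0 add0r map_mxM -CE mxspec_loc.
Qed.

End SpecializeMatrices.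

(** * Presentations of homology modules *)

Section HomologyPresentation.
Variables (T : comNzRingType) (a b r0 r1 r2 : nat).
Variables (D' : 'M[T]_(r0, r1)) (D : 'M[T]_(r1, r2)) (Q : 'M[T]_(a, b)).

Definition cocycle_mx : 'M[T]_(a * r1 + b * r2, a * r2) :=
  col_mx (lin_mx (mulmxr D)) (- lin_mx (mulmx Q)).

Definition coboundary_mx : 'M[T]_(a * r0 + b * r1, a * r1) :=
  col_mx (lin_mx (mulmxr D')) (lin_mx (mulmx Q)).

Lemma cocycle_mxE X Y :
  row_mx (mxvec X) (mxvec Y) *m cocycle_mx = mxvec (X *m D - Q *m Y).
Proof. by rewrite mul_row_col mulmxN !mul_vec_lin /= -linearB. Qed.

Lemma coboundary_mxE Z W :
  row_mx (mxvec Z) (mxvec W) *m coboundary_mx = mxvec (Z *m D' + Q *m W).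
Proof. by rewrite mul_row_col !mul_vec_lin /= -linearD. Qed.

Lemma mxvec2K p q p' q' (u : 'rV[T]_(p * q + p' * q')) :
  u = row_mx (mxvec (vec_mx (lsubmx u))) (mxvec (vec_mx (rsubmx u))).
Proof. by rewrite !vec_mxK hsubmxK. Qed.

(** The left block of [G] lists generating cocycles, that of [H] their relations modulo
    coboundaries. Both matrices only record kernels, so the presentation specializes; the transpose
    passes from rows to columns. *)
Lemma mx_homology_presentation s t (G : 'M[T]_(s, a * r1 + b * r2))
    (H : 'M[T]_(t, s + (a * r0 + b * r1))) (E : lmodType T) :
  (forall u : 'rV_(a * r1 + b * r2), u *m cocycle_mx = 0 <-> exists z, u = z *m G) ->
  (forall u : 'rV_(s + (a * r0 + b * r1)), u *m col_mx (lsubmx G) coboundary_mx = 0 <->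
     exists z, u = z *m H) ->
  mx_homology D' D Q E ->
  exists f : {linear 'cV[T]_s -> E}, surj f /\
    forall x, f x = 0 <-> exists z, x = (lsubmx H)^T *m z.
Proof.
move=> GP HP [f [fl fs fk]].
pose X (z : 'cV_s) : 'M_(a, r1) := vec_mx (z^T *m lsubmx G).
have cX z : mx_cocycle D Q (X z).
  have : z^T *m G *m cocycle_mx = 0 by apply/GP; exists z^T.
  rewrite (mxvec2K (z^T *m G)) cocycle_mxE => /(canRL mxvecK).
  rewrite linear0 => /eqP; rewrite subr_eq0 => /eqP XD.
  exists (vec_mx (rsubmx (z^T *m G))); rewrite -XD /X; congr (vec_mx _ *m _).
  by rewrite -{2}[G]hsubmxK mul_mx_row row_mxKl.
have lX c z z' : X (c *: z + z') = c *: X z + X z'.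
  by rewrite /X linearP mulmxDl -scalemxAl linearP.
have lfX : linear (fun z => f (X z)) by move=> c z z'; rewrite lX fl.
exists (mklin lfX); split=> [e|x].
  have [Y [W YW] <-] := fs e.
  have /GP[z zP] : row_mx (mxvec Y) (mxvec W) *m cocycle_mx = 0.
    by rewrite cocycle_mxE YW subrr linear0.
  exists z^T; congr (f _); rewrite /X trmxK.
  suff -> : z *m lsubmx G = mxvec Y by rewrite mxvecK.
  by move: zP; rewrite -{1}[G]hsubmxK mul_mx_row => /eq_row_mx[].
apply: (iff_trans (fk _ (cX x))); split=> [[Z [W XE]]|[z xE]].
  have /HP[z zP] : row_mx x^T (- row_mx (mxvec Z) (mxvec W)) *m
      col_mx (lsubmx G) coboundary_mx = 0.
    rewrite mul_row_col mulNmx coboundary_mxE -XE /X vec_mxK.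
    by rewrite subrr.
  exists z^T; apply: trmx_inj; rewrite trmx_mul !trmxK.
  by move: zP; rewrite -{1}[H]hsubmxK mul_mx_row => /eq_row_mx[].
have xT : x^T = z^T *m lsubmx H by rewrite xE trmx_mul trmxK.
pose v := z^T *m rsubmx H.
have : row_mx x^T v *m col_mx (lsubmx G) coboundary_mx = 0.
  by apply/HP; exists z^T; rewrite xT -mul_mx_row hsubmxK.
rewrite mul_row_col (mxvec2K v) coboundary_mxE => /eqP; rewrite addr_eq0 => /eqP e.
exists (- vec_mx (lsubmx v)), (- vec_mx (rsubmx v)).
by rewrite /X e linearN /= mxvecK mulNmx mulmxN opprD.
Qed.

End HomologyPresentation.

Lemma map_cocycle_mx (T S : comNzRingType) (g : {rmorphism T -> S}) a b r1 r2
    (D : 'M[T]_(r1, r2)) (Q : 'M[T]_(a, b)) :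
  map_mx g (cocycle_mx D Q) = cocycle_mx (map_mx g D) (map_mx g Q).
Proof.
rewrite /cocycle_mx map_col_mx map_mxN.
by congr (col_mx _ (- _)); apply: map_lin_mx => X; rewrite /= map_mxM.
Qed.

Lemma map_coboundary_mx (T S : comNzRingType) (g : {rmorphism T -> S}) a b r0 r1
    (D : 'M[T]_(r0, r1)) (Q : 'M[T]_(a, b)) :
  map_mx g (coboundary_mx D Q) = coboundary_mx (map_mx g D) (map_mx g Q).
Proof.
rewrite /coboundary_mx map_col_mx.
by congr col_mx; apply: map_lin_mx => X; rewrite /= map_mxM.
Qed.

Section PresentationMaps.
Variables (T : comNzRingType) (p q p' q' : nat).
Variables (P : 'M[T]_(p, q)) (P' : 'M[T]_(p', q')).

(* Mutually inverse maps between [coker P] and [coker P'], as matrix identities. *)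
Definition coker_equiv (U : 'M_(p', p)) (V : 'M_(p, p')) (X : 'M_(q', q))
    (Y : 'M_(q, q')) (Z : 'M_(q, p)) (W : 'M_(q', p')) :=
  [/\ U *m P = P' *m X, V *m P' = P *m Y, V *m U = 1%:M + P *m Z
    & U *m V = 1%:M + P' *m W].

Lemma coker_equiv_iso U V X Y Z W : coker_equiv U V X Y Z W ->
  isomorphic (coker (mulmx P : {linear 'cV_q -> 'cV_p}))
             (coker (mulmx P' : {linear 'cV_q' -> 'cV_p'})).
Proof.
move=> [UP VP' VU UV].
have [c [cs ck]] := coker_proj (mulmx P : {linear 'cV_q -> 'cV_p}).
have [c' [cs' ck']] := coker_proj (mulmx P' : {linear 'cV_q' -> 'cV_p'}).
have lg : linear (fun x : 'cV_p => c' (U *m x)).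
  by move=> r x y; rewrite mulmxDr -scalemxAr linearP.
apply: (iso_of_surj (f := c) (g := mklin lg)) => // [e|x].
  have [y <-] := cs' e; exists (V *m y); rewrite -[LHS]/(c' (U *m (V *m y))) mulmxA UV.
  rewrite mulmxDl mul1mx linearD -mulmxA.
  have -> : c' (P' *m (W *m y)) = 0 by apply/ck'; exists (W *m y).
  by rewrite addr0.
split=> [/ck[z ->]|/ck'[z /= xz]].
  by apply/ck'; exists (X *m z); rewrite /= !mulmxA UP.
(* From [V U = 1 + P Z] and [U x = P' z] one gets [x = V P' z - P Z x = P (Y z - Z x)]. *)
apply/ck; exists (Y *m z - Z *m x) => /=.
have /eqP := congr1 (fun A : 'M_p => A *m x) VU.
rewrite mulmxDl mul1mx -mulmxA xz mulmxA VP' -subr_eq => /eqP e.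
by rewrite mulmxBr !mulmxA e.
Qed.

Lemma presentations_equiv (E : lmodType T) (f : {linear 'cV[T]_p -> E})
    (f' : {linear 'cV[T]_p' -> E}) :
  surj f -> surj f' -> (forall x, f x = 0 <-> exists z, x = P *m z) ->
  (forall x, f' x = 0 <-> exists z, x = P' *m z) ->
  exists U V X Y Z W, coker_equiv U V X Y Z W.
Proof.
move=> fs fs' fk fk'.
have [U UP] := q_lift fs' f; have [V VP] := q_lift fs f'.
have [X XP] : exists X : 'M_(q', q), U *m P = P' *m X.
  apply: (q_mulmx0 fk') => z; rewrite -mulmxA UP.
  by apply/fk; exists z.
have [Y YP] : exists Y : 'M_(q, q'), V *m P' = P *m Y.
  apply: (q_mulmx0 fk) => z; rewrite -mulmxA VP.
  by apply/fk'; exists z.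
have [Z ZP] : exists Z : 'M_(q, p), V *m U - 1%:M = P *m Z.
  by apply: (q_mulmx0 fk) => z; rewrite mulmxBl mul1mx linearB -mulmxA VP UP subrr.
have [W WP] : exists W : 'M_(q', p'), U *m V - 1%:M = P' *m W.
  by apply: (q_mulmx0 fk') => z; rewrite mulmxBl mul1mx linearB -mulmxA UP VP subrr.
by exists U, V, X, Y, Z, W; split; rewrite // -?ZP -?WP addrC subrK.
Qed.

End PresentationMaps.

(** * Generic points *)

Section Generic.
Variables (k : fieldType) (m n : nat) (K : fieldType) (iota : {rmorphism k -> K}).

Local Notation F := {fraction {mpoly k[m]}}.
Local Notation R := {mpoly F[n]}.
Local Notation mxsp al := (@mxspec k m n K iota al _ _).
Local Notation mxd al := (@mxdef k m n K iota al _ _).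

(** One polynomial over [k] bounds the exceptional set, so conjunctions reduce to products. *)
Definition generic (P : ('I_m -> K) -> Prop) :=
  exists2 q : {mpoly k[m]}, q != 0 & forall alpha, mmap iota alpha q != 0 -> P alpha.

Lemma generic_mono (P P' : ('I_m -> K) -> Prop) :
  (forall alpha, P alpha -> P' alpha) -> generic P -> generic P'.
Proof. by move=> PP' [q q0 qP]; exists q => // alpha /qP/PP'. Qed.

Lemma generic_and (P P' : ('I_m -> K) -> Prop) :
  generic P -> generic P' -> generic (fun alpha => P alpha /\ P' alpha).
Proof.
move=> [q q0 qP] [q' q'0 qP']; exists (q * q'); first by rewrite mulf_neq0.
move=> alpha; rewrite rmorphM mulf_eq0 negb_or => /andP[/qP Pa /qP' Pa'].
by split.
Qed.

Lemma generic_all (T : eqType) (P : T -> ('I_m -> K) -> Prop) (s : seq T) :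
  (forall x, generic (P x)) -> generic (fun alpha => forall x, x \in s -> P x alpha).
Proof.
move=> gP; elim: s => [|x s IHs]; first by exists 1 => //; apply: oner_neq0.
apply: generic_mono (generic_and (gP x) IHs) => alpha [Px Ps] y.
by rewrite inE => /orP[/eqP->|/Ps].
Qed.

Lemma generic_regular (D : seq F) :
  generic (fun alpha => {subset D <= regular iota alpha}).
Proof.
apply: (generic_all (P := fun x alpha => x \in regular iota alpha)) => x.
have [p [q [q0 ->]]] := fraction_num_den x; exists q => // alpha qa.
by apply/asboolP; exists p, q; split.
Qed.

Lemma generic_def p q (B : 'M[R]_(p, q)) : generic (fun alpha => mxd alpha B).
Proof.
apply: generic_mono (generic_regular (mxcoefs B)) => alpha DB.
by apply/mxdef_over/(mxcoefsP (D := mxcoefs B)).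
Qed.

Lemma generic_exact r p q (B : 'M[R]_(r, p)) (C : 'M[R]_(q, r)) :
  (forall u : 'rV_r, u *m B = 0 <-> exists z, u = z *m C) ->
  generic (fun alpha => [/\ mxd alpha B, mxd alpha C &
    forall u : 'rV_r, u *m mxsp alpha B = 0 <-> exists z, u = z *m mxsp alpha C]).
Proof.
move=> BC; have [s [Ds [sl sO sP]]] := split_mx B.
have [t [Dt [tl tO tP]]] := split_mx C.
apply: generic_mono (generic_and (generic_and (generic_def B) (generic_def C))
  (generic_and (generic_regular Ds) (generic_regular Dt))).
move=> alpha [[Bd Cd] [DsO DtO]]; split=> //.
exact: (exact_specialize BC sl sO sP tl tO tP).
Qed.

Lemma exact_tr (T : comNzRingType) p q r (B : 'M[T]_(p, q)) (C : 'M[T]_(q, r)) :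
  (forall u : 'rV_q, u *m B^T = 0 <-> exists z, u = z *m C^T) <->
  (forall x : 'cV_q, B *m x = 0 <-> exists z, x = C *m z).
Proof.
split=> BC x; have [BC1 BC2] := BC x^T; split.
- move=> Bx; have [|z zP] := BC1; first by rewrite -trmx_mul Bx trmx0.
  by exists z^T; apply: trmx_inj; rewrite trmx_mul trmxK.
- move=> [z xE]; apply: trmx_inj; rewrite trmx_mul trmx0; apply: BC2.
  by exists z^T; rewrite xE trmx_mul.
- move=> xB; have [|z zP] := BC1; first by apply: trmx_inj; rewrite trmx_mul trmxK xB trmx0.
  by exists z^T; apply: trmx_inj; rewrite trmx_mul !trmxK.
- move=> [z xE]; apply: trmx_inj; rewrite trmx_mul trmxK trmx0; apply: BC2.
  by exists z^T; rewrite xE trmx_mul trmxK.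
Qed.

Lemma mxspec_tr al p q (B : 'M[R]_(p, q)) : mxsp al B^T = (mxsp al B)^T.
Proof. by rewrite /mxspec map_trmx. Qed.

Lemma generic_exact_col p q r (B : 'M[R]_(p, q)) (C : 'M[R]_(q, r)) :
  (forall x : 'cV_q, B *m x = 0 <-> exists z, x = C *m z) ->
  generic (fun alpha => forall x : 'cV_q,
    mxsp alpha B *m x = 0 <-> exists z, x = mxsp alpha C *m z).
Proof.
move=> /exact_tr/generic_exact; apply: generic_mono => alpha [_ _].
by rewrite !mxspec_tr => /exact_tr.
Qed.

Lemma kernel_fg_col p q (B : 'M[R]_(p, q)) : exists r (C : 'M[R]_(q, r)),
  forall x : 'cV_q, B *m x = 0 <-> exists z, x = C *m z.
Proof.
have [r [C CP]] := kernel_fg B^T; exists r, C^T; apply/exact_tr => u.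
by rewrite trmxK.
Qed.

(** The given presentation of Ext is arbitrary and has to be compared with the computed one.
    Finitely many matrices link the two, and their identities survive specialization. *)
Lemma generic_coker p q p' q' (P : 'M[R]_(p, q)) (P' : 'M[R]_(p', q')) (E : lmodType R)
    (f : {linear 'cV[R]_p -> E}) (f' : {linear 'cV[R]_p' -> E}) :
  surj f -> surj f' -> (forall x, f x = 0 <-> exists z, x = P *m z) ->
  (forall x, f' x = 0 <-> exists z, x = P' *m z) ->
  generic (fun alpha => isomorphic
    (coker (mulmx (mxsp alpha P) : {linear 'cV_q -> 'cV_p}))
    (coker (mulmx (mxsp alpha P') : {linear 'cV_q' -> 'cV_p'}))).
Proof.
move=> fs fs' fk fk'.
have [U [V [X [Y [Z [W [UP VP VU UV]]]]]]] := presentations_equiv fs fs' fk fk'.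
apply: generic_mono (generic_and (generic_and (generic_and (generic_def P) (generic_def P'))
  (generic_and (generic_def U) (generic_def V)))
  (generic_and (generic_and (generic_def X) (generic_def Y))
  (generic_and (generic_def Z) (generic_def W)))).
move=> alpha [[[Pd Pd'] [Ud Vd]] [[Xd Yd] [Zd Wd]]].
have def1 r : mxd alpha (1%:M : 'M_r).
  by rewrite -(map_mx1 (@loc_inj k m n K iota alpha)); apply: mxdef_loc.
have defM a b c (B : 'M_(a, b)) (C : 'M_(b, c)) :
    mxd alpha B -> mxd alpha C -> mxd alpha (B *m C).
  by move=> /mxdef_over oB /mxdef_over oC; apply/mxdef_over/overM.
apply: (@coker_equiv_iso _ _ _ _ _ _ _ (mxsp alpha U) (mxsp alpha V) (mxsp alpha X)
  (mxsp alpha Y) (mxsp alpha Z) (mxsp alpha W)); split.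
- by rewrite -!mxspecM // UP.
- by rewrite -!mxspecM // VP.
- by rewrite -!mxspecM // VU mxspecD ?mxspec1 //; apply: defM.
- by rewrite -!mxspecM // UV mxspecD ?mxspec1 //; apply: defM.
Qed.

Lemma mxspec_cocycle al a b r1 r2 (D : 'M[R]_(r1, r2)) (Q : 'M[R]_(a, b)) :
  mxd al D -> mxd al Q -> mxsp al (cocycle_mx D Q) = cocycle_mx (mxsp al D) (mxsp al Q).
Proof.
move=> /lift_mx[D1 <-] /lift_mx[Q1 <-].
by rewrite -map_cocycle_mx !mxspec_loc map_cocycle_mx.
Qed.

Lemma mxspec_coboundary al a b r0 r1 (D : 'M[R]_(r0, r1)) (Q : 'M[R]_(a, b)) :
  mxd al D -> mxd al Q ->
  mxsp al (coboundary_mx D Q) = coboundary_mx (mxsp al D) (mxsp al Q).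
Proof.
move=> /lift_mx[D1 <-] /lift_mx[Q1 <-].
by rewrite -map_coboundary_mx !mxspec_loc map_coboundary_mx.
Qed.

(** [G] and [H] specialize to generators of the kernels for the specialized complex, so the
    specialized presentation matrix presents [E'] too. *)
Lemma generic_homology a b r0 r1 r2 (D' : 'M[R]_(r0, r1)) (D : 'M[R]_(r1, r2))
    (Q : 'M[R]_(a, b)) (E : lmodType R) (PE : presentation E) :
  mx_homology D' D Q E ->
  generic (fun alpha => forall E' : lmodType {mpoly adjoin iota alpha[n]},
    mx_homology (mxsp alpha D') (mxsp alpha D) (mxsp alpha Q) E' ->
    isomorphic (spec_coker iota alpha PE) E').
Proof.
move=> hE.
have [s [G GP]] := kernel_fg (cocycle_mx D Q).
have [t [H HP]] := kernel_fg (col_mx (lsubmx G) (coboundary_mx D' Q)).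
have [f [fs fk]] := mx_homology_presentation GP HP hE.
have gs : surj (pres_aug PE) := @pres_surj _ _ PE.
have gk := @pres_exact _ _ PE.
apply: generic_mono (generic_and (generic_coker gs fs gk fk)
  (generic_and (generic_and (generic_exact GP) (generic_exact HP))
  (generic_and (generic_def D') (generic_and (generic_def D) (generic_def Q))))).
move=> alpha [iso [[[_ _ GPa] [_ _ HPa]] [Dd' [Dd Qd]]]] E' hE'.
rewrite mxspec_cocycle // in GPa.
have e : mxsp alpha (col_mx (lsubmx G) (coboundary_mx D' Q)) =
    col_mx (lsubmx (mxsp alpha G)) (coboundary_mx (mxsp alpha D') (mxsp alpha Q)).
  rewrite /mxspec map_col_mx map_lsubmx; congr col_mx.
  exact: mxspec_coboundary.
rewrite {}e in HPa.
have [f' [fs' fk']] := mx_homology_presentation GPa HPa hE'.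
apply: isomorphic_trans iso _.
have [c [cs ck]] := coker_proj (mulmx (mxsp alpha (lsubmx H)^T) :
  {linear 'cV_t -> 'cV_s}).
have e : mxsp alpha (lsubmx H)^T = (lsubmx (mxsp alpha H))^T.
  by rewrite mxspec_tr /mxspec map_lsubmx.
apply: (iso_of_surj cs fs') => x; apply: (iff_trans (ck x)).
apply: iff_sym; apply: (iff_trans (fk' x)).
by rewrite -e.
Qed.

End Generic.

Lemma meval_map_mpoly m (T S : comNzRingType) (f : {rmorphism T -> S}) (v : 'I_m -> S)
  (p : {mpoly T[m]}) : (map_mpoly f p).@[v] = mmap f v p.
Proof.
rewrite /map_mpoly /mmap raddf_sum; apply: eq_bigr => d _.
by rewrite /= mevalM mevalC mmap1_id mevalX.
Qed.

Lemma mmap_comp m (T S : comNzRingType) (f : {rmorphism T -> S}) (a : 'I_m -> T)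
  (p : {mpoly T[m]}) : mmap f (f \o a) p = f p.@[a].
Proof.
rewrite mevalE rmorph_sum; apply: eq_bigr => d _; rewrite rmorphM rmorph_prod.
by congr (_ * _); apply: eq_bigr => i _; rewrite rmorphXn.
Qed.

Section Main.
Variables (k : fieldType) (m n : nat) (K : fieldType) (iota : {rmorphism k -> K}).
Local Notation R := (gen_ring k m n).

Lemma almost_all_generic (P : ('I_m -> K) -> Prop) :
  infinite_set [set: k]%classic -> generic iota P -> almost_all P.
Proof.
move=> k_inf [q q0 qP]; exists [:: map_mpoly iota q]; split=> [e|alpha nz].
  have [a a0] := infinite_mpoly_nonroot k_inf q0.
  have : zero_locus [:: map_mpoly iota q] (iota \o a) by rewrite e.
  move/(_ _ (mem_head _ _)) => /eqP; apply/negP.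
  by rewrite meval_map_mpoly mmap_comp fmorph_eq0.
apply: qP; apply: contra_notN nz => /eqP q0' p.
by rewrite inE => /eqP->; rewrite meval_map_mpoly.
Qed.

Lemma spec_coker_presentation alpha (P : free_map R) :
  exists c : {linear 'cV_(fm_cod P) -> spec_coker iota alpha P}, surj c /\
    forall x, c x = 0 <-> exists z, x = mxspec iota alpha (fm_mx P) *m z.
Proof. exact: coker_proj. Qed.

Section FixM.
Variables (M : lmodType R) (PM : presentation M).

Lemma generic_ext i (L : lmodType R) (PL : presentation L)
    (PE : presentation (Ext i L M)) :
  generic iota (fun alpha => isomorphic (spec_coker iota alpha PE)
    (Ext i (spec_coker iota alpha PL) (spec_coker iota alpha PM))).
Proof.
have qs : surj (pres_aug PM) := @pres_surj _ _ PM.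
have qk := @pres_exact _ _ PM.
elim: i L PL PE => [|i IHi] L PL PE;
  have cs : surj (pres_aug PL) := @pres_surj _ _ PL;
  have ck := @pres_exact _ _ PL.
  apply: generic_mono (generic_homology iota PE (ext0_matrix qs qk cs ck)) => alpha; apply.
  have [q' [qs' qk']] := spec_coker_presentation alpha PM.
  have [c' [cs' ck']] := spec_coker_presentation alpha PL.
  rewrite mxspec0; exact: ext0_matrix qs' qk' cs' ck'.
have [p2 [D1 D01]] := kernel_fg_col (fm_mx PL).
have gD := generic_exact_col iota D01.
case: i IHi PE => [|i] IHi PE.
  apply: generic_mono (generic_and gD
    (generic_homology iota PE (ext1_matrix qs qk cs ck D01))) => alpha [D01a].
  apply.
  have [q' [qs' qk']] := spec_coker_presentation alpha PM.
  have [c' [cs' ck']] := spec_coker_presentation alpha PL.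
  have h := ext1_matrix qs' qk' cs' ck' D01a; exact: h.
pose P1 := FreeMap D1; pose L' := coker (mulmx D1 : {linear 'cV_p2 -> 'cV_(fm_dom PL)}).
have [c1 [cs1 ck1]] := coker_proj (mulmx D1 : {linear 'cV_p2 -> 'cV_(fm_dom PL)}).
pose PL' : presentation L' := @Presentation _ L' P1 c1 cs1 ck1.
have [h [h' hK h'K]] := ext_shift_matrix M cs ck D01 i cs1 ck1.
have lg : linear (h \o pres_aug PE) by move=> r x y; rewrite /= !linearP.
have gs : surj (mklin lg).
  move=> e; have [x xP] := pres_surj PE (h' e).
  by exists x; apply: etrans (congr1 h xP) (h'K e).
have gk x : mklin lg x = 0 <-> exists z, x = fm_mx PE *m z.
  apply: iff_trans (@pres_exact _ _ PE x); split=> [h0|x0].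
    by apply: (can_inj hK); apply: etrans h0 (esym (linear0 h)).
  exact: etrans (congr1 h x0) (linear0 h).
(* The matrix is that of [PE], so [spec_coker] is unchanged; only the augmentation is transported
   along the shift. *)
pose PE' : presentation (Ext i.+1 L' M) := @Presentation _ _ (pres_map PE) (mklin lg) gs gk.
(* Where [D1] still generates the kernel, [spec_coker] of [PL'] is a syzygy of that of [PL], and the
   shift also holds over k(alpha)[x]. *)
apply: generic_mono (generic_and gD (IHi L' PL' PE')) => alpha [D01a iso].
apply: (isomorphic_trans iso); apply: isomorphic_sym.
have [c' [cs' ck']] := spec_coker_presentation alpha PL.
have [c1' [cs1' ck1']] := spec_coker_presentation alpha PL'.
have := ext_shift_matrix (spec_coker iota alpha PM) cs' ck' D01a i cs1' ck1'; exact.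
Qed.

Lemma generic_specializes i (L : lmodType R) (PL : presentation L)
    (PE : presentation (Ext i L M)) :
  generic iota (fun alpha => ext_specializes iota alpha PL PM PE).
Proof.
apply: generic_mono (generic_and (generic_and (generic_def iota (fm_mx PL))
  (generic_def iota (fm_mx PM))) (generic_and (generic_def iota (fm_mx PE))
  (generic_ext PL PE))).
move=> alpha [[dL dM] [dE iso]].
by split=> // i' j'; apply/asboolP; [apply: dL | apply: dM | apply: dE].
Qed.

End FixM.

End Main.

Lemma isomorphic_zero (R : nzRingType) (U V : lmodType R) :
  (forall x : U, x = 0) -> (forall x : V, x = 0) -> isomorphic U V.
Proof.
move=> U0 V0; exists (GRing.null_fun _ : {linear U -> V}), (fun=> 0) => x.
  by rewrite [RHS]U0.
by rewrite [RHS]V0.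
Qed.

Unset Implicit Arguments.

(* [PE] chooses a presentation of every Ext module.  One exceptional subvariety
   cannot serve all degrees if the zero module is presented by infinitely many
   different matrices (e.g. the 1 x 1 matrices [u - c_i]).  So the uniform part
   takes into account that a presentation is attached to a module: the Ext
   modules that vanish, i.e. the zero module, share one presentation. *)
Theorem theorem4p3 (k : fieldType) (k_inf : infinite_set [set: k]%classic)
    (m n : nat) (K : fieldType) (iota : {rmorphism k -> K})
    (L M : lmodType (gen_ring k m n))
    (PL : presentation L) (PM : presentation M)
    (PE : forall i, presentation (Ext i L M)) :
  (forall i, almost_all (fun alpha : 'I_m -> K =>
     ext_specializes iota alpha PL PM (PE i))) /\
  ((forall i j,
      (forall x : Ext i L M, x = 0) -> (forall x : Ext j L M, x = 0) ->
      pres_map (PE i) = pres_map (PE j)) ->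
   almost_all (fun alpha : 'I_m -> K =>
     forall i, ext_specializes iota alpha PL PM (PE i))).
Proof.
have gen i := generic_specializes iota PM PL (PE i).
split=> [i|PE0]; apply: (almost_all_generic k_inf); first exact: gen.
(* Degrees 0 to [n.+1]: in degree [n.+1] Ext already vanishes, and its presentation is the one
   shared by all higher degrees. *)
apply: generic_mono (generic_all (seq.iota 0 n.+2) gen) => alpha spec_le i.
have [i_le|n_lt] := ltnP i n.+2; first by apply: spec_le; rewrite mem_iota.
have ext0 j : (n < j)%N -> forall x : Ext j L M, x = 0.
  by move=> nj; apply: ext_vanish (@pres_surj _ _ PL) (@pres_exact _ _ PL) nj.
have [c [cs ck]] := spec_coker_presentation iota alpha PL.
have ext0a j : (n < j)%N ->
    forall x : Ext j (spec_coker iota alpha PL) (spec_coker iota alpha PM), x = 0.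
  by move=> nj; apply: ext_vanish cs ck nj.
have [dL dM] : [/\ spec_defined iota alpha PL & spec_defined iota alpha PM].
  by have [] := spec_le 0%N (mem_head _ _).
have [|_ _ dE isoE] := spec_le n.+1; first by rewrite mem_iota /= add0n.
have e : pres_map (PE i) = pres_map (PE n.+1).
  by apply: PE0; apply: ext0 => //; apply: ltnW.
split=> //; first by move: dE; rewrite /spec_defined -e.
move: isoE; rewrite -e => isoE; apply: (isomorphic_trans isoE).
by apply: isomorphic_zero; apply: ext0a => //; apply: ltnW.
Qed.
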